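(* Let $\varepsilon\in\{1,-1\}$ and $n\ge1$, and write $+=1$, $-=-1$ for the index $\eta$ of $b_{n,\eta,\varepsilon}$. Under the algebra isomorphism $\Psi_\varepsilon\colon\mathrm{TL}(B_n)_\varepsilon\xrightarrow{\cong}\mathrm{End}_{U_q'(\mathfrak{gl}_1)}(V_\varepsilon^{\otimes n})$, the element $b_{n,\varepsilon,\varepsilon}$ corresponds to the idempotent projection $$V_\varepsilon^{\otimes n}\to L(\varepsilon^{n-1}[n])\hookrightarrow V_\varepsilon^{\otimes n},$$ and the element $b_{n,-\varepsilon,\varepsilon}$ corresponds to the idempotent projection $$V_\varepsilon^{\otimes n}\to L(-\varepsilon^{n-1}[n])\hookrightarrow V_\varepsilon^{\otimes n}.$$ The element $d_{n,\varepsilon}=b_{n,+,\varepsilon}+b_{n,-,\varepsilon}$ corresponds to the projection onto $L([n])\oplus L(-[n])$.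
   Context: The ground field is $k=\mathbb{C}(q)$, $[n]=\frac{q^n-q^{-n}}{q-q^{-1}}$. $U_q(\mathfrak{sl}_2)$ is the $k$-algebra generated by $E,F,K,K^{-1}$ with $KK^{-1}=1=K^{-1}K$, $KE=q^2EK$, $KF=q^{-2}FK$, $EF-FE=\frac{K-K^{-1}}{q-q^{-1}}$, and $\Delta(E)=E\otimes1+K\otimes E$, $\Delta(F)=F\otimes K^{-1}+1\otimes F$, $\Delta(K)=K\otimes K$. $V_\varepsilon$ has basis $x_\varepsilon,y_\varepsilon$ with $Ex_\varepsilon=0$, $Ey_\varepsilon=x_\varepsilon$, $Fx_\varepsilon=\varepsilon y_\varepsilon$, $Fy_\varepsilon=0$, $Kx_\varepsilon=\varepsilon qx_\varepsilon$, $Ky_\varepsilon=\varepsilon q^{-1}y_\varepsilon$. $U_q'(\mathfrak{gl}_1)$ is the subalgebra generated by $B=q^{-1}EK^{-1}+F$, with $\Delta(B)=B\otimes K^{-1}+1\otimes B$. $L(\lambda)$ is the one-dimensional module on which $B$ acts by $\lambda$. As a $U_q'(\mathfrak{gl}_1)$-module $V_\varepsilon^{\otimes n}\cong\bigoplus_{k=0}^nL([n-2k])^{\oplus\binom nk}$ ($B$-eigenspace decomposition); in particular $L([n])$ and $L(-[n])$ occur exactly once each, and the projections are taken along this decomposition. $\mathrm{TL}(B_n)_\varepsilon$ is the unital $k$-algebra with generators $s_0,U_1,\dots,U_{n-1}$ and relations $U_i^2=-\varepsilon(q+q^{-1})U_i$; $U_iU_j=U_jU_i$ for $|i-j|\ge2$;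 $U_iU_{i\pm1}U_i=U_i$; $s_0^2=1$; $U_1s_0U_1=0$; $s_0U_i=U_is_0$ for $i\ge2$. $\mathrm{TL}(B_n)_\varepsilon\subset\mathrm{TL}(B_{n+1})_\varepsilon$ in the obvious way. $\Psi_\varepsilon$ is the isomorphism with $s_0\mapsto\kappa\otimes\mathrm{id}^{\otimes(n-1)}$, where $\kappa$ swaps $x_\varepsilon,y_\varepsilon$, and $U_i\mapsto\mathrm{id}^{\otimes(i-1)}\otimes\underline H\otimes\mathrm{id}^{\otimes(n-i-1)}$, where $\underline H=R-\varepsilon q^{-\varepsilon}\mathrm{id}$ and $R$ is given by $x\otimes x\mapsto\varepsilon q^{-\varepsilon}x\otimes x$, $y\otimes y\mapsto\varepsilon q^{-\varepsilon}y\otimes y$, $x\otimes y\mapsto y\otimes x+\delta_{\varepsilon,-1}(q^{-1}-q)x\otimes y$, $y\otimes x\mapsto x\otimes y+\delta_{\varepsilon,1}(q^{-1}-q)y\otimes x$. For $\eta\in\{+,-\}$ the elements $b_{n,\eta,\varepsilon}\in\mathrm{TL}(B_n)_\varepsilon$ (type $B_n$ Jones--Wenzl projectors) are defined by $b_{1,\eta,\varepsilon}=\frac12(1+\eta s_0)$ and $$b_{n+1,\eta,\varepsilon}=b_{n,\eta,\varepsilon}+\varepsilon\frac{q^{n-1}+q^{-(n-1)}}{q^n+q^{-n}}\,b_{n,\eta,\varepsilon}U_nb_{n,\eta,\varepsilon}.$$ *)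

(* Defs.v *)
From HB Require Import structures.
From mathcomp Require Import all_boot all_order all_algebra.
From mathcomp Require Import ring.
From mathcomp Require Import boolp reals.
From mathcomp Require Import complex mxtens.

Set Implicit Arguments.
Unset Strict Implicit.
Unset Printing Implicit Defensive.

Import GRing.Theory.
Local Open Scope ring_scope.
Local Open Scope quotient_scope.

(* [pres rel] is the unital associative K-algebra with generators G and
   relations s = t for [rel s t]: noncommutative polynomial expressions modulo
   the smallest congruence that contains [rel] and the algebra axioms. *)

Inductive term (K G : Type) : Type :=
| Gen of G
| Cst of K
| Add of term K G & term K G
| Mul of term K G & term K G.
Arguments Gen {K G}.
Arguments Cst {K G}.
Arguments Add {K G}.
Arguments Mul {K G}.

HB.instance Definition _ K G := gen_eqMixin (term K G).
HB.instance Definition _ K G := gen_choiceMixin (term K G).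

Declare Scope term_scope.
Delimit Scope term_scope with trm.
Bind Scope term_scope with term.
Notation "s + t" := (Add s t) : term_scope.
Notation "s * t" := (Mul s t) : term_scope.
Notation "c *: t" := (Mul (Cst c%R) t) : term_scope.
Notation "s - t" := (Add s (Mul (Cst (-1)%R) t)) : term_scope.

Section Presentation.
Variables (K : fieldType) (G : Type).
Implicit Types (s t u : term K G) (a b : K).

Inductive cong (rel : term K G -> term K G -> Prop) :
    term K G -> term K G -> Prop :=
| cong_rel s t : rel s t -> cong rel s t
| cong_refl s : cong rel s s
| cong_sym s t : cong rel s t -> cong rel t s
| cong_trans s t u : cong rel s t -> cong rel t u -> cong rel s u
| cong_add s s' t t' :
    cong rel s s' -> cong rel t t' -> cong rel (s + t) (s' + t')
| cong_mul s s' t t' :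
    cong rel s s' -> cong rel t t' -> cong rel (s * t) (s' * t')
| cong_addA s t u : cong rel (s + (t + u)) (s + t + u)
| cong_addC s t : cong rel (s + t) (t + s)
| cong_add0 s : cong rel (Cst 0 + s) s
| cong_addN s : cong rel (s - s) (Cst 0)
| cong_mulA s t u : cong rel (s * (t * u)) (s * t * u)
| cong_mul1l s : cong rel (Cst 1 * s) s
| cong_mul1r s : cong rel (s * Cst 1) s
| cong_mulDl s t u : cong rel ((s + t) * u) (s * u + t * u)
| cong_mulDr s t u : cong rel (s * (t + u)) (s * t + s * u)
| cong_cstD a b : cong rel (Cst (a + b)) (Cst a + Cst b)
| cong_cstM a b : cong rel (Cst (a * b)) (Cst a * Cst b)
| cong_cstC a s : cong rel (Cst a * s) (s * Cst a).

Variable rel : term K G -> term K G -> Prop.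

Definition congb s t := `[< cong rel s t >].

Lemma congb_refl : reflexive congb.
Proof. by move=> s; apply/asboolP/cong_refl. Qed.
Lemma congb_sym : symmetric congb.
Proof. by move=> s t; apply/asboolP/asboolP => /cong_sym. Qed.
Lemma congb_trans : transitive congb.
Proof. by move=> s t u /asboolP st /asboolP tu; apply/asboolP/cong_trans/tu. Qed.

Canonical congb_equiv := EquivRel congb congb_refl congb_sym congb_trans.

Definition pres := {eq_quot congb}.
HB.instance Definition _ : EqQuotient _ congb pres := EqQuotient.on pres.
HB.instance Definition _ := Choice.on pres.

Lemma presP s t : cong rel s t <-> \pi_pres s = \pi_pres t.
Proof.
split => [st|/eqquotP/asboolP//]; by apply/eqquotP/asboolP.
Qed.

Lemma cong_repr s : cong rel (repr (\pi_pres s)) s.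
Proof. by apply/presP; rewrite reprK. Qed.

Definition pres_add (x y : pres) : pres := \pi_pres (repr x + repr y)%trm.
Definition pres_mul (x y : pres) : pres := \pi_pres (repr x * repr y)%trm.
Definition pres_cst a : pres := \pi_pres (Cst a).
Definition pres_opp (x : pres) : pres := pres_mul (pres_cst (-1)) x.
Definition pres_gen g : pres := \pi_pres (Gen g).

Lemma pres_addE s t : pres_add (\pi_pres s) (\pi_pres t) = \pi_pres (s + t)%trm.
Proof. by apply/presP; apply: cong_add; apply: cong_repr. Qed.
Lemma pres_mulE s t : pres_mul (\pi_pres s) (\pi_pres t) = \pi_pres (s * t)%trm.
Proof. by apply/presP; apply: cong_mul; apply: cong_repr. Qed.

Lemma pres_addA : associative pres_add.
Proof.
by elim/quotW=> s; elim/quotW=> t; elim/quotW=> u;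
  rewrite (pres_addE t u) (pres_addE s t) 2!pres_addE; apply/presP;
  apply: cong_addA.
Qed.
Lemma pres_addC : commutative pres_add.
Proof.
by elim/quotW=> s; elim/quotW=> t; rewrite !pres_addE; apply/presP; apply: cong_addC.
Qed.
Lemma pres_add0 : left_id (pres_cst 0) pres_add.
Proof. by elim/quotW=> s; rewrite !pres_addE; apply/presP; apply: cong_add0. Qed.
Lemma pres_mulA : associative pres_mul.
Proof.
by elim/quotW=> s; elim/quotW=> t; elim/quotW=> u; 
  rewrite (pres_mulE t u) (pres_mulE s t) 2!pres_mulE; apply/presP;
  apply: cong_mulA.
Qed.
Lemma pres_mul1l : left_id (pres_cst 1) pres_mul.
Proof. by elim/quotW=> s; rewrite !pres_mulE; apply/presP; apply: cong_mul1l. Qed.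
Lemma pres_mul1r : right_id (pres_cst 1) pres_mul.
Proof. by elim/quotW=> s; rewrite !pres_mulE; apply/presP; apply: cong_mul1r. Qed.
Lemma pres_mulDl : left_distributive pres_mul pres_add.
Proof.
by elim/quotW=> s; elim/quotW=> t; elim/quotW=> u;
  rewrite (pres_addE s t) (pres_mulE s u) (pres_mulE t u) pres_mulE pres_addE;
  apply/presP; apply: cong_mulDl.
Qed.
Lemma pres_mulDr : right_distributive pres_mul pres_add.
Proof.
by elim/quotW=> s; elim/quotW=> t; elim/quotW=> u;
  rewrite (pres_addE t u) (pres_mulE s t) (pres_mulE s u) pres_mulE pres_addE;
  apply/presP; apply: cong_mulDr.
Qed.
Lemma pres_cstD a b : pres_cst (a + b) = pres_add (pres_cst a) (pres_cst b).
Proof. by rewrite pres_addE; apply/presP; apply: cong_cstD. Qed.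
Lemma pres_cstM a b : pres_cst (a * b) = pres_mul (pres_cst a) (pres_cst b).
Proof. by rewrite pres_mulE; apply/presP; apply: cong_cstM. Qed.
Lemma pres_cstC a x : pres_mul (pres_cst a) x = pres_mul x (pres_cst a).
Proof. by elim/quotW: x => s; rewrite !pres_mulE; apply/presP; apply: cong_cstC. Qed.
Lemma pres_addN : left_inverse (pres_cst 0) pres_opp pres_add.
Proof.
elim/quotW=> s; rewrite /pres_opp /pres_cst pres_mulE pres_addC pres_addE.
apply/presP; apply: cong_addN.
Qed.

HB.instance Definition _ := GRing.isPzRing.Build pres
  pres_addA pres_addC pres_add0 pres_addN
  pres_mulA pres_mul1l pres_mul1r pres_mulDl pres_mulDr.

Fact pres_scaleA a b (x : pres) :
  pres_mul (pres_cst a) (pres_mul (pres_cst b) x)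
  = pres_mul (pres_cst (a * b)) x.
Proof. by rewrite pres_cstM pres_mulA. Qed.
Fact pres_scaleDl (x : pres) :
  {morph (fun a => pres_mul (pres_cst a) x) : a b / a + b}.
Proof. by move=> a b; rewrite pres_cstD pres_mulDl. Qed.

HB.instance Definition _ := GRing.Zmodule_isLmodule.Build K pres
  pres_scaleA pres_mul1l (fun a => pres_mulDr (pres_cst a)) pres_scaleDl.

Fact pres_scaleAl a (x y : pres) : a *: (x * y) = (a *: x) * y.
Proof. exact: pres_mulA. Qed.
Fact pres_scaleAr a (x y : pres) : a *: (x * y) = x * (a *: y).
Proof.
rewrite /GRing.scale /=.
by rewrite [LHS]pres_mulA pres_cstC -[LHS]pres_mulA.
Qed.

(** Universal property: a map on generators into a ring [A], with constants
    interpreted by a ring morphism [c] with central image, factors through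
    [pres rel] as soon as it satisfies the relations. *)

Section Lift.
Variables (A : pzRingType) (c : {rmorphism K -> A}) (f : G -> A).

Fixpoint eval s : A :=
  match s with
  | Gen g => f g
  | Cst a => c a
  | Add s t => eval s + eval t
  | Mul s t => eval s * eval t
  end.

Hypothesis cC : forall a x, c a * x = x * c a.
Hypothesis frel : forall s t, rel s t -> eval s = eval t.

Lemma eval_cong s t : cong rel s t -> eval s = eval t.
Proof.
elim=> {s t} /=.
- by move=> s t; apply: frel.
- by [].
- by [].
- by move=> s t u _ -> _ ->.
- by move=> s s' t t' _ -> _ ->.
- by move=> s s' t t' _ -> _ ->.
- by move=> s t u; rewrite addrA.
- by move=> s t; rewrite addrC.
- by move=> s; rewrite rmorph0 add0r.
- by move=> s; rewrite rmorphN1 mulN1r subrr rmorph0.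
- by move=> s t u; rewrite mulrA.
- by move=> s; rewrite rmorph1 mul1r.
- by move=> s; rewrite rmorph1 mulr1.
- by move=> s t u; rewrite mulrDl.
- by move=> s t u; rewrite mulrDr.
- by move=> a b; rewrite rmorphD.
- by move=> a b; rewrite rmorphM.
- by move=> a s; rewrite cC.
Qed.
End Lift.
End Presentation.

Section LiftDef.
Variables (K : fieldType) (G : Type) (rel : term K G -> term K G -> Prop).
Variables (A : pzRingType) (c : {rmorphism K -> A}) (f : G -> A).
Hypothesis cC : forall a x, c a * x = x * c a.
Hypothesis frel : forall s t, rel s t -> eval c f s = eval c f t.

Definition lift (x : pres rel) : A := eval c f (repr x).

Lemma lift_pi s : lift (\pi_(pres rel) s) = eval c f s.
Proof. exact: (eval_cong cC frel (cong_repr rel s)). Qed.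
Lemma lift_gen g : lift (pres_gen rel g) = f g.
Proof. exact: lift_pi. Qed.
Lemma lift_cst a : lift (pres_cst rel a) = c a.
Proof. exact: lift_pi. Qed.
Lemma liftD x y : lift (x + y) = lift x + lift y.
Proof.
elim/quotW: x => s; elim/quotW: y => t.
by rewrite [_ + _]pres_addE !lift_pi.
Qed.
Lemma liftM x y : lift (x * y) = lift x * lift y.
Proof.
elim/quotW: x => s; elim/quotW: y => t.
by rewrite [_ * _]pres_mulE !lift_pi.
Qed.
Lemma lift1 : lift 1 = 1. Proof. by rewrite lift_cst rmorph1. Qed.
Lemma liftZ a x : lift (a *: x) = c a * lift x.
Proof. by rewrite -lift_cst -liftM. Qed.
End LiftDef.

(* A field of characteristic other than 2 with a parameter q that is neither 0
   nor a root of unity; the definitions below are made over such a field, and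
   applied to C(q). *)
Record qfield := QField {
  qf :> fieldType;
  q : qf;
  q_neq0 : q != 0;
  q_expn_neq1 : forall n, (0 < n)%N -> q ^+ n != 1;
  two_neq0 : 2 != 0 :> qf
}.
Arguments q {_}.

Section Cq.
Variable R : realType.

Let X : {fraction {poly R[i]}} := tofrac ('X : {poly R[i]}).

Fact X_neq0 : X != 0.
Proof. by rewrite tofrac_eq0 polyX_eq0. Qed.

Fact X_expn_neq1 n : (0 < n)%N -> X ^+ n != 1.
Proof.
move=> n0; rewrite -(rmorphXn (@tofrac _)) -(rmorph1 (@tofrac _)) tofrac_eq.
apply/eqP => /(congr1 (fun p : {poly R[i]} => size p)).
by rewrite size_polyXn size_poly1 => -[] n00; rewrite n00 in n0.
Qed.

Fact fraction_two_neq0 : 2 != 0 :> {fraction {poly R[i]}}.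
Proof.
rewrite -(rmorph_nat (@tofrac _)) -(rmorph0 (@tofrac _)) tofrac_eq.
by rewrite -polyC_natr polyC_eq0 Num.Theory.pnatr_eq0.
Qed.

(* C(q): a realType is a model of the real numbers, so R[i] is C. *)
Definition Cq : qfield := QField X_neq0 X_expn_neq1 fraction_two_neq0.
End Cq.

Section QInt.
Variable k : qfield.

Lemma qBV_neq0 : (q : k) - q^-1 != 0.
Proof.
rewrite subr_eq0; apply: contra (q_expn_neq1 k (ltn0Sn 1)) => /eqP qV.
by rewrite expr2 {1}qV mulVf // q_neq0.
Qed.

Definition qint (m : int) : k := (q ^ m - q ^ (- m)) / (q - q^-1).
End QInt.

Variant sign := Plus | Minus.
Definition opps (e : sign) := if e is Plus then Minus else Plus.
Definition sgr (A : pzRingType) (e : sign) : A := if e is Plus then 1 else -1.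
Arguments sgr : clear implicits.
Coercion sgz (e : sign) : int := sgr int e.

Section Tens.
Variable K : comPzRingType.

Lemma tensDl m n p r (A A' : 'M[K]_(m, n)) (B : 'M[K]_(p, r)) :
  (A + A') *t B = A *t B + A' *t B.
Proof. by apply/matrixP=> i j; rewrite !mxE mulrDl. Qed.
Lemma tensDr m n p r (A : 'M[K]_(m, n)) (B B' : 'M[K]_(p, r)) :
  A *t (B + B') = A *t B + A *t B'.
Proof. by apply/matrixP=> i j; rewrite !mxE mulrDr. Qed.
Lemma tensZl m n p r a (A : 'M[K]_(m, n)) (B : 'M[K]_(p, r)) :
  (a *: A) *t B = a *: (A *t B).
Proof. by apply/matrixP=> i j; rewrite !mxE mulrA. Qed.
Lemma tensZr m n p r a (A : 'M[K]_(m, n)) (B : 'M[K]_(p, r)) :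
  A *t (a *: B) = a *: (A *t B).
Proof. by apply/matrixP=> i j; rewrite !mxE mulrCA. Qed.

Lemma tensBl m n p r (A A' : 'M[K]_(m, n)) (B : 'M[K]_(p, r)) :
  (A - A') *t B = A *t B - A' *t B.
Proof. by apply/matrixP=> i j; rewrite !mxE mulrBl. Qed.
Lemma tensBr m n p r (A : 'M[K]_(m, n)) (B B' : 'M[K]_(p, r)) :
  A *t (B - B') = A *t B - A *t B'.
Proof. by apply/matrixP=> i j; rewrite !mxE mulrBr. Qed.

Lemma tens_delta m n p r (i : 'I_m) (j : 'I_n) (k : 'I_p) (l : 'I_r) :
  delta_mx i j *t delta_mx k l
  = delta_mx (mxtens_index (i, k)) (mxtens_index (j, l)) :> 'M[K]_(_, _).
Proof.
apply/matrixP=> a b; case: (mxtens_indexP a) => a1 a2.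
case: (mxtens_indexP b) => b1 b2; rewrite tensmxE !mxE.
rewrite !(can_eq (@mxtens_indexK _ _)) !xpair_eqE -natrM mulnb.
by congr ((_ : bool)%:R); rewrite andbACA.
Qed.

Lemma tens11 m n : (1%:M : 'M[K]_m) *t (1%:M : 'M[K]_n) = 1%:M.
Proof.
apply/matrixP=> a b; case: (mxtens_indexP a) => a1 a2.
case: (mxtens_indexP b) => b1 b2; rewrite tensmxE !mxE.
by rewrite (can_eq (@mxtens_indexK _ _)) xpair_eqE -natrM mulnb.
Qed.

(* U ⊗ (V ⊗ W) is identified with (U ⊗ V) ⊗ W *)
Definition assoc (m n p : nat) (A : 'M[K]_(m * (n * p))) : 'M[K]_(m * n * p) :=
  castmx (mulnA m n p, mulnA m n p) A.

Lemma assoc_tens m n p (A : 'M[K]_m) (B : 'M[K]_n) (C : 'M[K]_p) :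
  assoc (A *t (B *t C)) = A *t B *t C.
Proof.
apply/matrixP=> a b; rewrite castmxE.
case: (mxtens_indexP a) => a' a3; case: (mxtens_indexP a') => a1 a2.
case: (mxtens_indexP b) => b' b3; case: (mxtens_indexP b') => b1 b2.
have E (x : 'I_m) (y : 'I_n) (z : 'I_p) :
    cast_ord (esym (mulnA m n p)) (mxtens_index (mxtens_index (x, y), z))
    = mxtens_index (x, mxtens_index (y, z)).
  by apply: val_inj; rewrite /= mulnDl mulnA addnA.
by rewrite !E !tensmxE mulrA.
Qed.

Lemma assocM m n p (A B : 'M[K]_(m * (n * p))) :
  assoc (A *m B) = assoc A *m assoc B.
Proof. by rewrite /assoc; case: _ / (mulnA m n p). Qed.
Lemma assocD m n p (A B : 'M[K]_(m * (n * p))) :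
  assoc (A + B) = assoc A + assoc B.
Proof. by rewrite /assoc; case: _ / (mulnA m n p). Qed.
Lemma assocZ m n p a (A : 'M[K]_(m * (n * p))) :
  assoc (a *: A) = a *: assoc A.
Proof. by rewrite /assoc; case: _ / (mulnA m n p). Qed.
Lemma assoc0 m n p : assoc (0 : 'M[K]_(m * (n * p))) = 0.
Proof. by rewrite /assoc; case: _ / (mulnA m n p). Qed.
End Tens.

Variant uq_gen := gE | gF | gK | gKi.

Section Uq.
Variable k : qfield.
Local Notation tE := (Gen gE : term k uq_gen).
Local Notation tF := (Gen gF : term k uq_gen).
Local Notation tK := (Gen gK : term k uq_gen).
Local Notation tKi := (Gen gKi : term k uq_gen).

Inductive uq_rel : term k uq_gen -> term k uq_gen -> Prop :=
| uq_KKi : uq_rel (tK * tKi) (Cst 1)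
| uq_KiK : uq_rel (tKi * tK) (Cst 1)
| uq_KE : uq_rel (tK * tE) ((q ^ 2) *: (tE * tK))
| uq_KF : uq_rel (tK * tF) ((q ^ (-2)) *: (tF * tK))
| uq_EF : uq_rel (tE * tF - tF * tE) ((q - q^-1)^-1 *: (tK - tKi)).

Definition Uq := pres uq_rel.
HB.instance Definition _ := GRing.PzRing.on Uq.
HB.instance Definition _ := GRing.Lmodule.on Uq.

(* A left U_q(sl_2)-module structure on the column vectors of size d: matrices,
   acting by left multiplication, that satisfy the defining relations. *)
Record uqmod (d : nat) := UqMod {
  uqmod_gen : uq_gen -> 'M[k]_d;
  uqmod_rel : forall s t, uq_rel s t ->
    eval (@scalar_mx k d) uqmod_gen s = eval (@scalar_mx k d) uqmod_gen t
}.

Definition act d (M : uqmod d) : Uq -> 'M[k]_d :=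
  lift (@scalar_mx k d) (uqmod_gen M).

Lemma mk_uqmod_rel d (e f g gi : 'M[k]_d) :
    g *m gi = 1%:M -> gi *m g = 1%:M ->
    g *m e = q ^ 2 *: (e *m g) -> g *m f = q ^ (-2) *: (f *m g) ->
    e *m f - f *m e = (q - q^-1)^-1 *: (g - gi) ->
  let h x := match x with gE => e | gF => f | gK => g | gKi => gi end in
  forall s t, uq_rel s t ->
    eval (@scalar_mx k d) h s = eval (@scalar_mx k d) h t.
Proof.
move=> h1 h2 h3 h4 h5 h s t.
have S a (A : 'M[k]_d) : a%:M * A = a *: A by exact: mul_scalar_mx.
by case=> /=; rewrite ?S ?scaleN1r.
Qed.

Definition mk_uqmod d (e f g gi : 'M[k]_d) h1 h2 h3 h4 h5 :=
  UqMod (@mk_uqmod_rel d e f g gi h1 h2 h3 h4 h5).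

Definition vx : 'cV[k]_2 := delta_mx 0 0.
Definition vy : 'cV[k]_2 := delta_mx 1 0.
Variable e : sign.
Local Notation ee := (sgr k e).

(* [v *m w^T] sends the basis vector w to v and the other basis vectors to 0 *)
Definition vE : 'M[k]_2 := vx *m vy^T.
Definition vF : 'M[k]_2 := (ee *: vy) *m vx^T.
Definition vK : 'M[k]_2 := (ee * q) *: (vx *m vx^T) + (ee * q^-1) *: (vy *m vy^T).
Definition vKi : 'M[k]_2 := (ee * q^-1) *: (vx *m vx^T) + (ee * q) *: (vy *m vy^T).

Lemma ext2 m (A B : 'M[k]_(m, 2)) : A *m vx = B *m vx -> A *m vy = B *m vy -> A = B.
Proof.
rewrite -!colE => hx hy; apply/matrixP => i j.
have /(congr1 (fun C : 'M_(m, 1) => C i 0)) := hx.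
have /(congr1 (fun C : 'M_(m, 1) => C i 0)) := hy.
rewrite !mxE => ey ex; case: j => -[|[|//]] ?.
  by rewrite (_ : Ordinal _ = 0) //; apply: val_inj.
by rewrite (_ : Ordinal _ = 1) //; apply: val_inj.
Qed.

Lemma bra (a b : 'I_2) :
  (delta_mx a 0 : 'cV[k]_2)^T *m (delta_mx b 0 : 'cV[k]_2) = (a == b)%:R%:M.
Proof.
rewrite trmx_delta; apply/matrixP => i j; rewrite !ord1 mxE.
rewrite !big_ord_recl big_ord0 !mxE /=.
by case: a b => -[|[|//]] ? [[|[|//]] ?]; rewrite ?mulr1 ?mulr0 ?addr0 ?add0r.
Qed.
Lemma bra_xx : vx^T *m vx = 1%:M. Proof. exact: bra. Qed.
Lemma bra_xy : vx^T *m vy = 0. Proof. by rewrite bra raddf0. Qed.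
Lemma bra_yx : vy^T *m vx = 0. Proof. by rewrite bra raddf0. Qed.
Lemma bra_yy : vy^T *m vy = 1%:M. Proof. exact: bra. Qed.
Definition braE := (bra_xx, bra_xy, bra_yx, bra_yy, mulmx0, mulmx1,
  scaler0, addr0, add0r).

Lemma vEx : vE *m vx = 0. Proof. by rewrite -mulmxA !braE. Qed.
Lemma vEy : vE *m vy = vx. Proof. by rewrite -mulmxA !braE. Qed.
Lemma vFx : vF *m vx = ee *: vy. Proof. by rewrite -mulmxA !braE. Qed.
Lemma vFy : vF *m vy = 0. Proof. by rewrite -mulmxA !braE. Qed.
Lemma vKx : vK *m vx = (ee * q) *: vx.
Proof. by rewrite mulmxDl -!scalemxAl -!mulmxA !braE. Qed.
Lemma vKy : vK *m vy = (ee * q^-1) *: vy.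
Proof. by rewrite mulmxDl -!scalemxAl -!mulmxA !braE. Qed.
Lemma vKix : vKi *m vx = (ee * q^-1) *: vx.
Proof. by rewrite mulmxDl -!scalemxAl -!mulmxA !braE. Qed.
Lemma vKiy : vKi *m vy = (ee * q) *: vy.
Proof. by rewrite mulmxDl -!scalemxAl -!mulmxA !braE. Qed.
Definition vgenE := (vEx, vEy, vFx, vFy, vKx, vKy, vKix, vKiy).

Lemma sgr2 : ee * ee = 1.
Proof. by rewrite /sgr; case: e; rewrite ?mulrNN mul1r. Qed.

Lemma qexp2 : (q : k) ^ 2 = q * q. Proof. by rewrite -exprnP expr2. Qed.
Lemma qexpN2 : (q : k) ^ (-2) = q^-1 * q^-1.
Proof. by rewrite -[-2%Z]/(- (2%N : int)) -exprnN -exprVn expr2. Qed.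

Lemma vKKi : vK *m vKi = 1%:M.
Proof.
apply: ext2; rewrite -(mulmxA vK) !vgenE -scalemxAr !vgenE mul1mx scalerA.
  by rewrite mulrACA sgr2 mulVf ?q_neq0 // mulr1 scale1r.
by rewrite mulrACA sgr2 mulfV ?q_neq0 // mulr1 scale1r.
Qed.
Lemma vKiK : vKi *m vK = 1%:M.
Proof.
apply: ext2; rewrite -(mulmxA vKi) !vgenE -scalemxAr !vgenE mul1mx scalerA.
  by rewrite mulrACA sgr2 mulfV ?q_neq0 // mulr1 scale1r.
by rewrite mulrACA sgr2 mulVf ?q_neq0 // mulr1 scale1r.
Qed.
Lemma vKE : vK *m vE = q ^ 2 *: (vE *m vK).
Proof.
apply: ext2; rewrite -scalemxAl -(mulmxA vK) -(mulmxA vE) !vgenE -?scalemxAr ?vgenE ?mulmx0 ?vgenE ?mulmx0.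
  by rewrite !scaler0.
by rewrite scalerA mulrCA qexp2 -mulrA mulfV ?q_neq0 // mulr1.
Qed.
Lemma vKF : vK *m vF = q ^ (-2) *: (vF *m vK).
Proof.
apply: ext2; rewrite -scalemxAl -(mulmxA vK) -(mulmxA vF) !vgenE -?scalemxAr ?vgenE ?mulmx0 ?vgenE ?mulmx0.
  rewrite !scalerA; congr (_ *: _).
  by rewrite qexpN2; field; exact: q_neq0.
by rewrite !scaler0.
Qed.
Lemma vEF : vE *m vF - vF *m vE = (q - q^-1)^-1 *: (vK - vKi).
Proof.
have q0 := q_neq0 k; have q1 := qBV_neq0 k.
apply: ext2; rewrite -scalemxAl !mulmxBl -(mulmxA vE) -(mulmxA vF) !vgenE -?scalemxAr ?vgenE.
  rewrite mulmx0 subr0 -scalerBl scalerA -mulrBr mulrCA mulVf // mulr1 //.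
rewrite mulmx0 sub0r -scalerBl scalerA -mulrBr.
rewrite -[X in _ * (_ * X)]opprB !mulrN mulrCA mulVf //.
by rewrite mulr1 scaleNr.
Qed.

Definition Vmod : uqmod 2 := mk_uqmod vKKi vKiK vKE vKF vEF.

Definition trivmod : uqmod 1.
Proof.
refine (@mk_uqmod 1 0 0 1%:M 1%:M _ _ _ _ _); rewrite ?mul1mx ?mulmx1 //.
- by rewrite scaler0.
- by rewrite scaler0.
- by rewrite mulmx0 !subrr scaler0.
Defined.

Section TensMod.
Variables (d1 d2 : nat) (M : uqmod d1) (N : uqmod d2).
Local Notation a := (uqmod_gen M).
Local Notation b := (uqmod_gen N).

(* Delta(E) = E⊗1 + K⊗E, Delta(F) = F⊗K^-1 + 1⊗F, Delta(K) = K⊗K *)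
Definition tens_gen (x : uq_gen) : 'M[k]_(d1 * d2) :=
  match x with
  | gE => a gE *t 1%:M + a gK *t b gE
  | gF => a gF *t b gKi + 1%:M *t b gF
  | gK => a gK *t b gK
  | gKi => a gKi *t b gKi
  end.

End TensMod.

Section ModRel.
Variables (d : nat) (M : uqmod d).
Local Notation a := (uqmod_gen M).
Let S c (A : 'M[k]_d) : c%:M * A = c *: A. Proof. exact: mul_scalar_mx. Qed.

Lemma mod_KKi : a gK *m a gKi = 1%:M. Proof. exact: (uqmod_rel M uq_KKi). Qed.
Lemma mod_KiK : a gKi *m a gK = 1%:M. Proof. exact: (uqmod_rel M uq_KiK). Qed.
Lemma mod_KE : a gK *m a gE = q ^ 2 *: (a gE *m a gK).
Proof. by have /= := uqmod_rel M uq_KE; rewrite S. Qed.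
Lemma mod_KF : a gK *m a gF = q ^ (-2) *: (a gF *m a gK).
Proof. by have /= := uqmod_rel M uq_KF; rewrite S. Qed.
Lemma mod_EF : a gE *m a gF - a gF *m a gE = (q - q^-1)^-1 *: (a gK - a gKi).
Proof. by have /= := uqmod_rel M uq_EF; rewrite !S !scaleN1r. Qed.
Lemma mod_KiF : a gKi *m a gF = q ^ 2 *: (a gF *m a gKi).
Proof.
have q0 := q_neq0 k.
rewrite -[LHS]mulmx1 -mod_KKi mulmxA -(mulmxA _ (a gF)).
have -> : a gF *m a gK = q ^ 2 *: (a gK *m a gF).
  rewrite mod_KF scalerA (_ : _ * _ = 1) ?scale1r //.
  by rewrite qexp2 qexpN2; field.
by rewrite -scalemxAr mulmxA mod_KiK mul1mx -scalemxAl.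
Qed.
Lemma mod_KiE : a gE *m a gKi = q ^ 2 *: (a gKi *m a gE).
Proof.
rewrite -[LHS]mul1mx -mod_KiK -mulmxA (mulmxA (a gK)) mod_KE.
by rewrite -scalemxAl -scalemxAr -(mulmxA (a gE)) mod_KKi mulmx1.
Qed.
End ModRel.

Fact add_cancel (V : zmodType) (a b c d x y : V) :
  a + b + (c + d) - (x + c + (b + y)) = (a - x) + (d - y).
Proof.
rewrite !opprD !addrA.
rewrite [LHS](ACl (1 * 5 * 4 * 8 * (2 * 7) * (3 * 6))) /=.
by rewrite !subrr !addr0 -addrA.
Qed.

Lemma tens_rel d1 d2 (M : uqmod d1) (N : uqmod d2) s t : uq_rel s t ->
  eval (@scalar_mx k _) (tens_gen M N) s = eval (@scalar_mx k _) (tens_gen M N) t.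
Proof.
set h := tens_gen M N.
suff : [/\ h gK *m h gKi = 1%:M, h gKi *m h gK = 1%:M,
    h gK *m h gE = q ^ 2 *: (h gE *m h gK),
    h gK *m h gF = q ^ (-2) *: (h gF *m h gK) &
    h gE *m h gF - h gF *m h gE = (q - q^-1)^-1 *: (h gK - h gKi)].
  case=> h1 h2 h3 h4 h5 st; have := mk_uqmod_rel h1 h2 h3 h4 h5 st.
  have E u : eval (@scalar_mx k _) (fun x => match x with gE => h gE
    | gF => h gF | gK => h gK | gKi => h gKi end) u = eval (@scalar_mx k _) h u.
    by elim: u => [[]|//|u /= -> v ->|u /= -> v ->].
  by rewrite !E.
rewrite /h /=; split.
- by rewrite tensmx_mul !mod_KKi tens11.
- by rewrite tensmx_mul !mod_KiK tens11.
- rewrite mulmxDr mulmxDl !tensmx_mul !mod_KE tensZl tensZr mulmx1 mul1mx.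
  by rewrite scalerDr.
- rewrite mulmxDr mulmxDl !tensmx_mul !mod_KF tensZl tensZr mod_KKi mod_KiK.
  by rewrite mulmx1 mul1mx scalerDr.
rewrite !(mulmxDr, mulmxDl) !tensmx_mul !(mulmx1, mul1mx).
rewrite mod_KF mod_KiE tensZl tensZr scalerA.
have -> : (q : k) ^ (-2) * q ^ 2 = 1.
  by rewrite qexp2 qexpN2; field; exact: q_neq0.
rewrite scale1r.
set x1 := _ *t _; set x2 := _ *t _; set x3 := _ *t _; set x4 := _ *t _.
set y1 := _ *t _; set y4 := _ *t _.
rewrite add_cancel /x1 /x4 /y1 /y4.
rewrite -tensBl -tensBr !mod_EF tensZl tensZr -scalerDr; congr (_ *: _).
by rewrite tensBl tensBr addrC addrA subrK.
Qed.

Definition tensmod d1 d2 (M : uqmod d1) (N : uqmod d2) : uqmod (d1 * d2) :=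
  UqMod (@tens_rel d1 d2 M N).

Fixpoint tdim (n : nat) : nat := if n is m.+1 then (tdim m * 2)%N else 1%N.

(* V_e^{⊗(n+1)} = V_e^{⊗n} ⊗ V_e, starting from the trivial module at n = 0. *)
Fixpoint Vn (n : nat) : uqmod (tdim n) :=
  if n is m.+1 then tensmod (Vn m) Vmod else trivmod.

Definition uE : Uq := pres_gen uq_rel gE.
Definition uF : Uq := pres_gen uq_rel gF.
Definition uK : Uq := pres_gen uq_rel gK.
Definition uKi : Uq := pres_gen uq_rel gKi.
Definition uB : Uq := q^-1 *: (uE * uKi) + uF.

Inductive gen_subalg (S : Uq -> Prop) : Uq -> Prop :=
| gsub_gen u : S u -> gen_subalg S u
| gsub1 : gen_subalg S 1
| gsubD u v : gen_subalg S u -> gen_subalg S v -> gen_subalg S (u + v)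
| gsubZ a u : gen_subalg S u -> gen_subalg S (a *: u)
| gsubM u v : gen_subalg S u -> gen_subalg S v -> gen_subalg S (u * v).

(* The coideal subalgebra U'_q(gl_1) generated by B. *)
Definition Uq' : Uq -> Prop := gen_subalg (fun u => u = uB).

Section Act.
Variables (d : nat) (M : uqmod d).
Let cC (a : k) (A : 'M[k]_d) : a%:M * A = A * a%:M.
Proof. by rewrite [LHS]mul_scalar_mx [RHS]mul_mx_scalar. Qed.
Lemma act_gen g : act M (pres_gen uq_rel g) = uqmod_gen M g.
Proof. apply: lift_gen; [exact: cC | exact: uqmod_rel]. Qed.
Lemma actD u v : act M (u + v) = act M u + act M v.
Proof. apply: liftD; [exact: cC | exact: uqmod_rel]. Qed.
Lemma act1 : act M 1 = 1%:M.
Proof. apply: lift1; [exact: cC | exact: uqmod_rel]. Qed.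
Lemma actM u v : act M (u * v) = act M u *m act M v.
Proof. apply: liftM; [exact: cC | exact: uqmod_rel]. Qed.
Lemma actZ a u : act M (a *: u) = a *: act M u.
Proof.
rewrite -mul_scalar_mx; apply: liftZ; [exact: cC | exact: uqmod_rel].
Qed.
Lemma actB : act M uB
  = q^-1 *: (uqmod_gen M gE *m uqmod_gen M gKi) + uqmod_gen M gF.
Proof. by rewrite actD actZ actM !act_gen. Qed.

(* End_{U'_q(gl_1)}(M), as a subtype of the endomorphisms of the space M. *)
Definition endU'_pred : pred 'M[k]_d :=
  fun A => `[< forall u, Uq' u -> A *m act M u = act M u *m A >].

Record endU' := EndU' { endU'_mx :> 'M[k]_d; endU'P : endU'_pred endU'_mx }.
HB.instance Definition _ := [isSub for endU'_mx].
HB.instance Definition _ := [Choice of endU' by <:].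

Fact endU'_subring : subring_closed endU'_pred.
Proof.
split; first by apply/asboolP => u _; rewrite mul1mx mulmx1.
- move=> A B /asboolP hA /asboolP hB; apply/asboolP => u Bu.
  by rewrite mulmxBl mulmxBr hA ?hB.
- move=> A B /asboolP hA /asboolP hB; apply/asboolP => u Bu.
  by rewrite -mulmxA hB // mulmxA hA // mulmxA.
Qed.
HB.instance Definition _ := GRing.isSubringClosed.Build _ endU'_pred endU'_subring.
Fact endU'_scale : GRing.scaler_closed endU'_pred.
Proof.
move=> a A /asboolP hA; apply/asboolP => u Bu.
by rewrite -scalemxAl -scalemxAr hA.
Qed.
HB.instance Definition _ := GRing.isScaleClosed.Build k _ endU'_pred endU'_scale.
HB.instance Definition _ := 
  GRing.SubChoice_isSubPzRing.Build _ _ endU' endU'_subring.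
HB.instance Definition _ := [SubZmodule_isSubLmodule of endU' by <:].

Lemma endU'_predP (A : 'M[k]_d) :
  A *m act M uB = act M uB *m A -> endU'_pred A.
Proof.
move=> AB; apply/asboolP => u; elim=> {u}.
- by move=> u ->.
- by rewrite act1 mulmx1 mul1mx.
- by move=> u v _ hu _ hv; rewrite actD mulmxDl mulmxDr hu hv.
- by move=> a u _ hu; rewrite actZ -scalemxAl -scalemxAr hu.
- by move=> u v _ hu _ hv; rewrite actM mulmxA hu -mulmxA hv mulmxA.
Qed.
End Act.

End Uq.

Section TL.
Variable k : qfield.
Variable e : sign.
Local Notation ee := (sgr k e).

(* [tlU i] with i : 'I_n.-1 is the generator U_{i+1}. *)
Variant tl_gen (n : nat) := tlS | tlU of 'I_n.-1.
Arguments tlS {n}.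
Arguments tlU {n}.

Section Rel.
Variable n : nat.
Local Notation S0 := (Gen tlS : term k (tl_gen n)).
Local Notation U i := (Gen (tlU i) : term k (tl_gen n)).

Inductive tl_rel : term k (tl_gen n) -> term k (tl_gen n) -> Prop :=
| tl_UU i : tl_rel (U i * U i) ((- (ee * (q + q^-1))) *: U i)
| tl_far (i j : 'I_n.-1) :
    (i.+2 <= j)%N || (j.+2 <= i)%N -> tl_rel (U i * U j) (U j * U i)
| tl_braid (i j : 'I_n.-1) :
    (j == i.+1 :> nat) || (i == j.+1 :> nat) -> tl_rel (U i * U j * U i) (U i)
| tl_SS : tl_rel (S0 * S0) (Cst 1)
| tl_U1SU1 (i : 'I_n.-1) : i = 0 :> nat -> tl_rel (U i * S0 * U i) (Cst 0)
| tl_SU (i : 'I_n.-1) : (1 <= i)%N -> tl_rel (S0 * U i) (U i * S0).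
End Rel.
Arguments tl_rel n _ _ : clear implicits.

Definition TL (n : nat) := pres (tl_rel n).
HB.instance Definition _ n := GRing.PzRing.on (TL n).
HB.instance Definition _ n := GRing.Lmodule.on (TL n).

Definition s0 n : TL n := pres_gen (tl_rel n) tlS.
Definition tU n (i : 'I_n.-1) : TL n := pres_gen (tl_rel n) (tlU i).

Local Notation x := (vx k).
Local Notation y := (vy k).

Definition kappa : 'M[k]_2 := y *m x^T + x *m y^T.

Definition Rmx : 'M[k]_(2 * 2) :=
    (ee * q ^ (- (e : int))) *: ((x *t x) *m (x *t x)^T)
  + (ee * q ^ (- (e : int))) *: ((y *t y) *m (y *t y)^T)
  + (y *t x + (if e is Minus then q^-1 - q else 0) *: (x *t y))
      *m (x *t y)^T
  + (x *t y + (if e is Plus then q^-1 - q else 0) *: (y *t x))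
      *m (y *t x)^T.

Definition Hmx : 'M[k]_(2 * 2) := Rmx - (ee * q ^ (- (e : int)))%:M.

(* κ ⊗ id^{⊗(n-1)} *)
Fixpoint s0mx (n : nat) : 'M[k]_(tdim n) :=
  if n is m.+1 then
    (if m is 0 then 1%:M *t kappa else s0mx m *t 1%:M)
  else 1%:M.

(* id^{⊗i} ⊗ H ⊗ id^{⊗(n-i-2)}, the image of U_{i+1}; the test selects the
   case where H sits on the last two factors. *)
Fixpoint Umx (n i : nat) : 'M[k]_(tdim n) :=
  match n with
  | 0 => 0
  | m.+1 =>
    (match m return 'M[k]_(tdim m) -> 'M[k]_(tdim m.+1) with
     | 0 => fun _ => 0
     | p.+1 => fun A =>
        if i == p then assoc ((1%:M : 'M_(tdim p)) *t Hmx) else A *t 1%:M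
     end) (Umx m i)
  end.

Lemma ext_tens m d p (A B : 'M[k]_(m, d * p)) :
  (forall i j, A *m (delta_mx i (0 : 'I_1) *t delta_mx j (0 : 'I_1))
             = B *m (delta_mx i (0 : 'I_1) *t delta_mx j (0 : 'I_1))) -> A = B.
Proof.
move=> h; apply/matrixP => a b; case: (mxtens_indexP b) => i j.
have := h i j; rewrite tens_delta.
move/(congr1 (fun C : 'M_(m, 1 * 1) => C a (mxtens_index (0, 0)))).
have E (C : 'M[k]_(m, d * p)) (l : 'I_(1 * 1)) :
    (C *m delta_mx (mxtens_index (i, j)) l) a l = C a (mxtens_index (i, j)).
  rewrite !mxE (bigD1 (mxtens_index (i, j))) //= mxE !eqxx mulr1 big1 ?addr0 //.
  by move=> c /negbTE hc; rewrite mxE hc mulr0.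
by rewrite !E.
Qed.

Lemma deltaP (i : 'I_2) : delta_mx i 0 = x \/ delta_mx i 0 = y.
Proof.
case: i => -[|[|//]] h; [left | right]; congr (delta_mx _ 0); exact: val_inj.
Qed.

Lemma ext4 m (A B : 'M[k]_(m, 2 * 2)) :
  A *m (x *t x) = B *m (x *t x) -> A *m (x *t y) = B *m (x *t y) ->
  A *m (y *t x) = B *m (y *t x) -> A *m (y *t y) = B *m (y *t y) -> A = B.
Proof.
move=> h1 h2 h3 h4; apply: ext_tens => i j.
by case: (deltaP i) => ->; case: (deltaP j) => ->.
Qed.

Lemma kappax : kappa *m x = y.
Proof. by rewrite mulmxDl -!(mulmxA _ _ x) !braE. Qed.
Lemma kappay : kappa *m y = x.
Proof. by rewrite mulmxDl -!(mulmxA _ _ y) !braE. Qed.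
Lemma kappa2 : kappa *m kappa = 1%:M.
Proof. by apply: ext2; rewrite -(mulmxA kappa) !(kappax, kappay) mul1mx. Qed.

Lemma braT (a b c d : 'cV[k]_2) :
  (a *t b)^T *m (c *t d) = (a^T *m c) *t (b^T *m d).
Proof. by rewrite trmx_tens tensmx_mul. Qed.
Let braTE := (braT, braE, tens0mx, tensmx0, tens11, mulmx0, mulmx1).

Lemma Rmx_xx : Rmx *m (x *t x) = (ee * q ^ (- (e : int))) *: (x *t x).
Proof.
by rewrite !mulmxDl -!scalemxAl -!(mulmxA _ _ (x *t x)) !braTE.
Qed.
Lemma Rmx_yy : Rmx *m (y *t y) = (ee * q ^ (- (e : int))) *: (y *t y).
Proof.
by rewrite !mulmxDl -!scalemxAl -!(mulmxA _ _ (y *t y)) !braTE.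
Qed.
Lemma Rmx_xy : Rmx *m (x *t y)
  = y *t x + (if e is Minus then q^-1 - q else 0) *: (x *t y).
Proof.
by rewrite !mulmxDl -!scalemxAl -!(mulmxA _ _ (x *t y)) !braTE.
Qed.
Lemma Rmx_yx : Rmx *m (y *t x)
  = x *t y + (if e is Plus then q^-1 - q else 0) *: (y *t x).
Proof.
by rewrite !mulmxDl -!scalemxAl -!(mulmxA _ _ (y *t x)) !braTE.
Qed.

Let t : k := - (ee * q^-1).
Let s : k := - (ee * q).
Let v := y *t x + t *: (x *t y).

Lemma st1 : s * t = 1.
Proof. by rewrite mulrNN mulrACA sgr2 mulfV ?q_neq0 // mulr1. Qed.

Lemma Hxx : Hmx *m (x *t x) = 0.
Proof. by rewrite mulmxBl Rmx_xx mul_scalar_mx subrr. Qed.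
Lemma Hyy : Hmx *m (y *t y) = 0.
Proof. by rewrite mulmxBl Rmx_yy mul_scalar_mx subrr. Qed.
Lemma Hxy : Hmx *m (x *t y) = v.
Proof.
rewrite mulmxBl Rmx_xy mul_scalar_mx -addrA -scalerBl; congr (_ + _ *: _).
by rewrite /t /sgr; case: e => /=; rewrite -?exprnN ?expr1z; field; rewrite ?q_neq0 //.
Qed.
Lemma Hyx : Hmx *m (y *t x) = s *: v.
Proof.
rewrite mulmxBl Rmx_yx mul_scalar_mx -addrA -scalerBl scalerDr scalerA st1.
rewrite scale1r [RHS]addrC; congr (_ + _ *: _).
by rewrite /s /sgr; case: e => /=; rewrite -?exprnN ?expr1z; field; rewrite ?q_neq0 //.
Qed.
Let HE := (Hxx, Hxy, Hyx, Hyy).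

Lemma Hv : Hmx *m v = (- (ee * (q + q^-1))) *: v.
Proof.
rewrite /v mulmxDr -scalemxAr !HE -scalerDl; congr (_ *: _).
by rewrite /s /t -opprD -mulrDr.
Qed.
Lemma H2 : Hmx *m Hmx = (- (ee * (q + q^-1))) *: Hmx.
Proof.
apply: ext4; rewrite -(mulmxA Hmx) -scalemxAl !HE ?mulmx0 ?scaler0 //.
  exact: Hv.
by rewrite -scalemxAr Hv !scalerA mulrC.
Qed.
Lemma HkH : Hmx *m (kappa *t 1%:M) *m Hmx = 0.
Proof.
have V : Hmx *m (kappa *t 1%:M) *m v = 0.
  rewrite /v mulmxDr -scalemxAr -!(mulmxA Hmx) !tensmx_mul !mul1mx.
  by rewrite kappax kappay !HE scaler0 addr0.
apply: ext4; rewrite -(mulmxA _ Hmx) mul0mx !HE ?mulmx0 //.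
by rewrite -scalemxAr V scaler0.
Qed.

Lemma Hpure : Hmx = (y *m x^T) *t (x *m y^T) + t *: ((x *m x^T) *t (y *m y^T))
  + s *: ((y *m y^T) *t (x *m x^T) + t *: ((x *m y^T) *t (y *m x^T))).
Proof.
have E (a b c d w w' : 'cV[k]_2) : ((a *m b^T) *t (c *m d^T)) *m (w *t w')
   = (a *m (b^T *m w)) *t (c *m (d^T *m w')) by rewrite tensmx_mul !mulmxA.
by apply: ext4; rewrite HE !mulmxDl -?scalemxAl !mulmxDl -?scalemxAl !E !braE
  !(tens0mx, tensmx0, scaler0, addr0, add0r).
Qed.

Section Top.
Variable d : nat.
Definition top : 'M[k]_(d * 2 * 2) := assoc ((1%:M : 'M_d) *t Hmx).

Lemma topE r (w : 'M[k]_(d, r)) (a b : 'cV[k]_2) : top *m (w *t a *t b)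
  = w *t (y *m (x^T *m a)) *t (x *m (y^T *m b))
  + t *: (w *t (x *m (x^T *m a)) *t (y *m (y^T *m b)))
  + s *: (w *t (y *m (y^T *m a)) *t (x *m (x^T *m b))
         + t *: (w *t (x *m (y^T *m a)) *t (y *m (x^T *m b)))).
Proof.
rewrite /top Hpure !(tensDr, tensZr, assocD, assocZ) !assoc_tens.
by rewrite !mulmxDl -!scalemxAl !mulmxDl -!scalemxAl !tensmx_mul !mul1mx !mulmxA.
Qed.
Let simp := (braE, tens0mx, tensmx0, scaler0, addr0, add0r).
Lemma topxx r (w : 'M[k]_(d, r)) : top *m (w *t x *t x) = 0.
Proof. by rewrite topE !simp. Qed.
Lemma topyy r (w : 'M[k]_(d, r)) : top *m (w *t y *t y) = 0.
Proof. by rewrite topE !simp. Qed.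
Lemma topxy r (w : 'M[k]_(d, r)) :
  top *m (w *t x *t y) = w *t y *t x + t *: (w *t x *t y).
Proof. by rewrite topE !simp. Qed.
Lemma topyx r (w : 'M[k]_(d, r)) :
  top *m (w *t y *t x) = s *: (w *t y *t x + t *: (w *t x *t y)).
Proof. by rewrite topE !simp. Qed.
End Top.
Let topsE := (topxx, topxy, topyx, topyy).
Arguments top : clear implicits.

Section Braid.
Variable d : nat.
Local Notation T := (top (d * 2)).
Local Notation P := (top d *t (1%:M : 'M_2)).
Variables (r : nat) (w : 'M[k]_(d, r)).

Lemma PE (u : 'M[k]_(d * 2 * 2, r * 1 * 1)) (c : 'cV[k]_2) :
  P *m (u *t c) = (top d *m u) *t c.
Proof. by rewrite tensmx_mul mul1mx. Qed.
Let rules := (PE, topsE, tens0mx, tensDl, tensZl, mulmx0, scaler0).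

Lemma TPv (a : 'cV[k]_2) : a = x \/ a = y ->
  T *m (P *m (w *t a *t y *t x + t *: (w *t a *t x *t y)))
  = w *t a *t y *t x + t *: (w *t a *t x *t y).
Proof.
case=> ->; rewrite !mulmxDr -!scalemxAr !rules.
  rewrite addr0 !mulmxDr -!scalemxAr !rules add0r scalerA (mulrC t) st1.
  by rewrite scale1r.
rewrite add0r -!scalemxAr !mulmxDr -!scalemxAr !rules !addr0 scalerA.
by rewrite (mulrC t) st1 scale1r.
Qed.

Lemma PTv (c : 'cV[k]_2) : c = x \/ c = y ->
  P *m (T *m (w *t y *t x *t c + t *: (w *t x *t y *t c)))
  = w *t y *t x *t c + t *: (w *t x *t y *t c).
Proof.
case=> ->; rewrite !mulmxDr -!scalemxAr !rules.
  rewrite add0r -!scalemxAr !mulmxDr -!scalemxAr !rules !addr0 scalerA.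
  by rewrite (mulrC t) st1 scale1r.
rewrite addr0 !mulmxDr -!scalemxAr !rules add0r.
by rewrite scalerA (mulrC t) st1 scale1r.
Qed.
End Braid.

Lemma ext3 d m (A B : 'M[k]_(m, d * 2 * 2 * 2)) :
  (forall (w : 'cV[k]_d) (a b c : 'cV[k]_2), a = x \/ a = y ->
     b = x \/ b = y -> c = x \/ c = y ->
     A *m (w *t a *t b *t c) = B *m (w *t a *t b *t c)) -> A = B.
Proof.
move=> h; apply: ext_tens => i l; case: (mxtens_indexP i) => {}i j.
case: (mxtens_indexP i) => {}i h'.
have D (p p' : nat) (a : 'I_p) (b : 'I_p') :
    delta_mx (mxtens_index (a, b)) (0 : 'I_1)
    = delta_mx a (0 : 'I_1) *t delta_mx b (0 : 'I_1) :> 'M[k]_(_, 1).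
  by rewrite tens_delta; congr delta_mx; apply: val_inj.
by rewrite !D; apply: h; apply: deltaP.
Qed.

Lemma braidT d : let T := top (d * 2) in let P := top d *t (1%:M : 'M_2) in
  T *m P *m T = T /\ P *m T *m P = P.
Proof.
move=> T P; split; apply: ext3 => w a b c ha hb hc.
  have V := TPv w ha.
  have U r (z : 'M[k]_(_, r)) : T *m (P *m z) = z -> T *m P *m z = z.
    by move=> h; rewrite -mulmxA.
  rewrite -(mulmxA (T *m P)).
  case: hb => ->; case: hc => ->; rewrite /T !topsE -?/T ?mulmx0 //.
    exact: U.
  by rewrite -scalemxAr U.
have V := PTv w hc.
rewrite -(mulmxA (P *m T)).
have U r (z : 'M[k]_(_, r)) : P *m (T *m z) = z -> P *m T *m z = z.
  by move=> h; rewrite -mulmxA.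
case: ha => ->; case: hb => ->; rewrite /P !PE !topsE ?tens0mx -?/P ?mulmx0 //.
  by rewrite tensDl tensZl U.
by rewrite tensZl -scalemxAr tensDl tensZl U.
Qed.

Lemma Umx_small n i : (i.+2 <= n)%N -> Umx n.+1 i = Umx n i *t 1%:M.
Proof. by case: n => // n; rewrite /= ltnS => /ltn_eqF ->. Qed.
Lemma Umx_top n : Umx n.+2 n = top (tdim n).
Proof. by rewrite /= eqxx. Qed.
Lemma s0mxS n : s0mx n.+2 = s0mx n.+1 *t 1%:M.
Proof. by []. Qed.

Lemma s0mx2 n : s0mx n *m s0mx n = 1%:M.
Proof.
elim: n => [|[|n] IH]; first by rewrite mulmx1.
  by rewrite tensmx_mul mulmx1 kappa2 tens11.
by rewrite s0mxS tensmx_mul IH mulmx1 tens11.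
Qed.

Lemma topUU d : top d *m top d = (- (ee * (q + q^-1))) *: top d.
Proof. by rewrite /top -assocM tensmx_mul mulmx1 H2 tensZr assocZ. Qed.

Lemma Umx2 n i : (i.+2 <= n)%N ->
  Umx n i *m Umx n i = (- (ee * (q + q^-1))) *: Umx n i.
Proof.
elim: n => // n IH; rewrite leq_eqVlt => /orP[/eqP[<-]|]; last first.
  rewrite ltnS => hi.
  by rewrite Umx_small // tensmx_mul IH // mulmx1 tensZl.
by rewrite Umx_top topUU.
Qed.

Lemma top_comm d (A : 'M[k]_d) :
  top d *m (A *t 1%:M *t 1%:M) = (A *t 1%:M *t 1%:M) *m top d.
Proof.
rewrite -assoc_tens /top -!assocM !tensmx_mul !tens11.
by rewrite !mulmx1 !mul1mx.
Qed.

Lemma Umx_far n i j : (i.+2 <= j)%N -> (j.+2 <= n)%N ->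
  Umx n i *m Umx n j = Umx n j *m Umx n i.
Proof.
move=> hij; elim: n => // n IH; rewrite leq_eqVlt => /orP[/eqP[E]|]; last first.
  rewrite ltnS => hj; have hi : (i.+2 <= n)%N.
    by rewrite (leq_trans hij) // (leq_trans _ hj) // leqW.
  by rewrite !Umx_small // !tensmx_mul IH.
case: n E {IH} => // n [<-]; rewrite Umx_top Umx_small; last first.
  by rewrite ltnW // ltnS.
by rewrite Umx_small // top_comm.
Qed.

Lemma Umx_braid n i : (i.+3 <= n)%N ->
  Umx n i *m Umx n i.+1 *m Umx n i = Umx n i /\
  Umx n i.+1 *m Umx n i *m Umx n i.+1 = Umx n i.+1.
Proof.
elim: n => // n IH; rewrite leq_eqVlt => /orP[/eqP[<-]|]; last first.
  rewrite ltnS => hi; have [h1 h2] := IH hi.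
  rewrite !Umx_small //; last exact: ltnW.
  by rewrite !tensmx_mul h1 h2 !mulmx1.
rewrite Umx_top Umx_small // Umx_top.
by have [h1 h2] := braidT (tdim i).
Qed.

Lemma U1s0U1 n : (2 <= n)%N -> Umx n 0 *m s0mx n *m Umx n 0 = 0.
Proof.
case: n => // -[|n] // _; elim: n => [|n IH].
  rewrite Umx_top s0mxS /top -assoc_tens -!assocM !tensmx_mul !mul1mx HkH.
  by rewrite tensmx0 assoc0.
by rewrite Umx_small // s0mxS !tensmx_mul IH tens0mx.
Qed.

Lemma s0U n i : (1 <= i)%N -> (i.+2 <= n)%N ->
  s0mx n *m Umx n i = Umx n i *m s0mx n.
Proof.
move=> i0; elim: n => // n IH; rewrite leq_eqVlt => /orP[/eqP[<-]|]; last first.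
  rewrite ltnS => hi; rewrite Umx_small //.
  have hn := IH hi; case: n hi hn {IH} => // n hi hn.
  by rewrite s0mxS !tensmx_mul hn.
by case: i i0 {IH} => // i _; rewrite Umx_top !s0mxS top_comm.
Qed.

Local Notation V := (Vmod k e).
Local Notation bV := (act V (uB k)).
Local Notation Ki := (vKi k e).

Lemma actB_tens d1 d2 (M : uqmod k d1) (N : uqmod k d2) :
  act (tensmod M N) (uB k)
  = act M (uB k) *t uqmod_gen N gKi + 1%:M *t act N (uB k).
Proof.
rewrite !actB /= mulmxDl !tensmx_mul mod_KKi mul1mx.
rewrite tensDl tensDr tensZl tensZr scalerDr !addrA; congr (_ + _).
by rewrite addrAC.
Qed.

Lemma actBV : bV = ee *: kappa.
Proof.
rewrite actB /=; apply: ext2; rewrite mulmxDl -!scalemxAl -(mulmxA (vE k)).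
  rewrite vKix -scalemxAr vEx vFx kappax scaler0 scaler0 add0r //.
rewrite vKiy -scalemxAr vEy vFy kappay addr0 scalerA mulrCA mulVf ?q_neq0 //.
by rewrite mulr1.
Qed.

Lemma actBn n : act (Vn k e n.+1) (uB k)
  = act (Vn k e n) (uB k) *t Ki + 1%:M *t bV.
Proof. exact: actB_tens. Qed.

Lemma actB0 : act (Vn k e 0) (uB k) = 0.
Proof. by rewrite actB /= mul0mx scaler0 addr0. Qed.

Fact KK1 : (ee * q^-1) * (ee * q) = 1.
Proof. by rewrite mulrACA sgr2 mulVf ?q_neq0 // mulr1. Qed.
Fact KK2 : (ee * q) * (ee * q^-1) = 1.
Proof. by rewrite mulrC KK1. Qed.

Lemma HKK : Hmx *m (Ki *t Ki) = (Ki *t Ki) *m Hmx.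
Proof.
have Kxy : (Ki *t Ki) *m (x *t y) = x *t y.
  by rewrite tensmx_mul vKix vKiy tensZl tensZr scalerA KK1 scale1r.
have Kyx : (Ki *t Ki) *m (y *t x) = y *t x.
  by rewrite tensmx_mul vKix vKiy tensZl tensZr scalerA KK2 scale1r.
have E : (Ki *t Ki) *m v = v by rewrite /v mulmxDr -scalemxAr Kxy Kyx.
apply: ext4; rewrite -(mulmxA Hmx) -(mulmxA (Ki *t Ki)) !HE ?Kxy ?Kyx ?HE ?E //.
- by rewrite tensmx_mul vKix tensZl tensZr -!scalemxAr Hxx !scaler0 mulmx0.
- by rewrite -scalemxAr E.
- by rewrite tensmx_mul vKiy tensZl tensZr -!scalemxAr Hyy !scaler0 mulmx0.
Qed.

Let B2 := bV *t Ki + 1%:M *t bV.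
Let B2E (a b : 'cV[k]_2) :
  B2 *m (a *t b) = (bV *m a) *t (Ki *m b) + a *t (bV *m b).
Proof. by rewrite mulmxDl !tensmx_mul mul1mx. Qed.
Let bx : bV *m x = ee *: y. Proof. by rewrite actBV -scalemxAl kappax. Qed.
Let by_ : bV *m y = ee *: x. Proof. by rewrite actBV -scalemxAl kappay. Qed.
Let B2_xx : B2 *m (x *t x) = q^-1 *: (y *t x) + ee *: (x *t y).
Proof. by rewrite B2E bx vKix !tensZl !tensZr scalerA mulrA sgr2 mul1r. Qed.
Let B2_xy : B2 *m (x *t y) = q *: (y *t y) + ee *: (x *t x).
Proof. by rewrite B2E bx by_ vKiy !tensZl !tensZr scalerA mulrA sgr2 mul1r. Qed.
Let B2_yx : B2 *m (y *t x) = q^-1 *: (x *t x) + ee *: (y *t y).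
Proof. by rewrite B2E bx by_ vKix !tensZl !tensZr scalerA mulrA sgr2 mul1r. Qed.
Let B2_yy : B2 *m (y *t y) = q *: (x *t y) + ee *: (y *t x).
Proof. by rewrite B2E by_ vKiy !tensZl !tensZr scalerA mulrA sgr2 mul1r. Qed.

Lemma HB0 : Hmx *m B2 = 0.
Proof.
apply: ext4; rewrite -(mulmxA Hmx) mul0mx ?(B2_xx, B2_xy, B2_yx, B2_yy)
  mulmxDr -!scalemxAr !HE ?scaler0 ?addr0 // scalerA -scalerDl.
- rewrite (_ : _ + _ = 0) ?scale0r // /s mulrN mulrCA mulVf ?q_neq0 // mulr1.
  by rewrite addNr.
- by rewrite (_ : _ + _ = 0) ?scale0r // /s mulrN mulrA sgr2 mul1r subrr.
Qed.
Lemma B0H : B2 *m Hmx = 0.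
Proof.
have E : B2 *m v = 0.
  rewrite /v mulmxDr -scalemxAr B2_xy B2_yx scalerDr !scalerA.
  rewrite /t !mulNr -mulrA mulVf ?q_neq0 // mulr1 mulrAC sgr2 mul1r !scaleNr.
  by rewrite [X in _ + X]addrC addrACA !subrr addr0.
apply: ext4; rewrite -(mulmxA B2) mul0mx !HE ?mulmx0 ?E //.
by rewrite -scalemxAr E scaler0.
Qed.

Lemma Umx_actB n i : (i.+2 <= n)%N ->
  Umx n i *m act (Vn k e n) (uB k) = act (Vn k e n) (uB k) *m Umx n i.
Proof.
elim: n => // n IH; rewrite leq_eqVlt => /orP[/eqP[<-]|]; last first.
  rewrite ltnS => hi; rewrite Umx_small // actBn mulmxDl mulmxDr !tensmx_mul.
  by rewrite IH // !mulmx1 !mul1mx.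
rewrite Umx_top !actBn tensDl -!addrA.
set A := act (Vn k e i) _.
have -> : A *t Ki *t Ki + (1%:M *t bV *t Ki + 1%:M *t bV)
    = assoc (A *t (Ki *t Ki) + 1%:M *t B2).
  by rewrite /B2 (tensDr _ (bV *t Ki)) !assocD !assoc_tens tens11.
rewrite /top -!assocM mulmxDl mulmxDr !tensmx_mul HB0 B0H HKK.
by rewrite !mulmx1 !mul1mx.
Qed.

Lemma s0mx_actB n :
  s0mx n *m act (Vn k e n) (uB k) = act (Vn k e n) (uB k) *m s0mx n.
Proof.
elim: n => [|[|n] IH].
- by rewrite actB0 mulmx0 mul0mx.
- rewrite actBn actB0 tens0mx add0r actBV /= !tensmx_mul !mul1mx.
  by rewrite -scalemxAl -scalemxAr.
rewrite s0mxS actBn mulmxDl mulmxDr !tensmx_mul IH.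
by rewrite !mulmx1 !mul1mx.
Qed.

Definition tl_mx n (g : tl_gen n) : 'M[k]_(tdim n) :=
  match g with tlS => s0mx n | tlU i => Umx n i end.

Fact ltU n (i : 'I_n.-1) : (i.+2 <= n)%N.
Proof. by case: n i => [[]|m] // i; apply: ltn_ord. Qed.

Fact tl_mx_rel n u u' : tl_rel n u u' ->
  eval (@scalar_mx k _) (@tl_mx n) u = eval (@scalar_mx k _) (@tl_mx n) u'.
Proof.
have hn := @ltU n.
case=> /= [i|i j|i j||i i0|i i0].
- by rewrite [LHS]Umx2 // [RHS]mul_scalar_mx.
- by case/orP=> hij; [rewrite [LHS]Umx_far | rewrite [RHS]Umx_far].
- case/orP=> /eqP E; have h := hn j; have h' := hn i; rewrite E in h h' *.
    by have [] := Umx_braid h.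
  by have [] := Umx_braid h'.
- exact: s0mx2.
- rewrite i0 raddf0; apply: U1s0U1; by apply: leq_trans (hn i).
- exact: s0U.
Qed.

Definition Psi_mx n : TL n -> 'M[k]_(tdim n) :=
  lift (@scalar_mx k (tdim n)) (@tl_mx n).

Section PsiMx.
Variable n : nat.
Let cC (a : k) (A : 'M[k]_(tdim n)) : a%:M * A = A * a%:M.
Proof. by rewrite [LHS]mul_scalar_mx [RHS]mul_mx_scalar. Qed.

Lemma Psi_mx_gen g : Psi_mx (pres_gen (tl_rel n) g) = tl_mx g.
Proof. by apply: lift_gen; [exact: cC | exact: tl_mx_rel]. Qed.
Lemma Psi_mxD : {morph @Psi_mx n : a b / a + b}.
Proof. by move=> a b; apply: liftD; [exact: cC | exact: tl_mx_rel]. Qed.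
Lemma Psi_mxM : {morph @Psi_mx n : a b / a * b >-> a *m b}.
Proof. by move=> a b; apply: liftM; [exact: cC | exact: tl_mx_rel]. Qed.
Lemma Psi_mx1 : Psi_mx (1 : TL n) = 1%:M.
Proof. by apply: lift1; [exact: cC | exact: tl_mx_rel]. Qed.
Lemma Psi_mxZ a (u : TL n) : Psi_mx (a *: u) = a *: Psi_mx u.
Proof.
by rewrite -mul_scalar_mx; apply: liftZ; [exact: cC | exact: tl_mx_rel].
Qed.

Lemma Psi_mx_end (a : TL n) : endU'_pred (Vn k e n) (Psi_mx a).
Proof.
apply: endU'_predP.
have Psi_pi u : Psi_mx (\pi_(pres (tl_rel n)) u) = eval (@scalar_mx k _) (@tl_mx n) u.
  by apply: lift_pi; [exact: cC | exact: tl_mx_rel].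
elim/quotW: a => u; rewrite {}Psi_pi.
elim: u => [[|i]|c|u hu u' hu'|u hu u' hu'] /=.
- exact: s0mx_actB.
- exact/Umx_actB/ltU.
- by rewrite mul_scalar_mx mul_mx_scalar.
- by rewrite mulmxDl mulmxDr hu hu'.
- by rewrite -[in LHS]mulmxA hu' mulmxA hu mulmxA.
Qed.
End PsiMx.

Fact tdim_gt0 n : (0 < tdim n)%N.
Proof. by elim: n => //= n IH; rewrite muln_gt0 IH. Qed.

Fact TL_nontrivial n : (1 : TL n) != 0.
Proof.
apply/eqP => /(congr1 (fun a => Psi_mx a - Psi_mx a *+ 2)).
rewrite Psi_mx1 -[in RHS](scale0r 0) Psi_mxZ !scale0r mul0rn subr0 => /matrixP.
move/(_ (Ordinal (tdim_gt0 n)) (Ordinal (tdim_gt0 n)))/eqP.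
by rewrite mulr2n opprD addrA subrr sub0r !mxE eqxx oppr_eq0 oner_eq0.
Qed.

HB.instance Definition _ n :=
  GRing.PzSemiRing_isNonZero.Build (TL n) (@TL_nontrivial n).
HB.instance Definition _ n :=
  GRing.Lmodule_isLalgebra.Build k (TL n) (@pres_scaleAl _ _ (tl_rel n)).
HB.instance Definition _ n :=
  GRing.Lalgebra_isAlgebra.Build k (TL n) (@pres_scaleAr _ _ (tl_rel n)).

(* The algebra morphism TL(B_n) -> End_{U'_q(gl_1)}(V_e^{⊗n}) determined by
   Psi_s0 and Psi_U below. *)
Definition Psi n (a : TL n) : endU' (Vn k e n) := EndU' (Psi_mx_end a).

Fact Psi_linear n : linear (@Psi n).
Proof.
move=> c a b; apply: val_inj; rewrite linearP /=.
by rewrite Psi_mxD Psi_mxZ.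
Qed.
Fact Psi_monoid n : monoid_morphism (@Psi n).
Proof.
split; first by apply: val_inj; rewrite rmorph1 /= Psi_mx1.
by move=> a b; apply: val_inj; rewrite rmorphM /= Psi_mxM.
Qed.
HB.instance Definition _ n :=
  GRing.isLinear.Build k (TL n) (endU' (Vn k e n)) _ (@Psi n) (@Psi_linear n).
HB.instance Definition _ n := GRing.isMonoidMorphism.Build
  (TL n) (endU' (Vn k e n)) (@Psi n) (@Psi_monoid n).

Lemma Psi_s0 n : endU'_mx (Psi (s0 n)) = s0mx n.
Proof. exact: Psi_mx_gen. Qed.
Lemma Psi_U n (i : 'I_n.-1) : endU'_mx (Psi (tU i)) = Umx n i.
Proof. exact: Psi_mx_gen. Qed.

Lemma TL_eval n (u : term k (tl_gen n)) :
  eval (in_alg (TL n)) (pres_gen (tl_rel n)) u = \pi_(pres (tl_rel n)) u.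
Proof.
elim: u => //= [c|u -> u' ->|u -> u' ->].
- exact: pres_mul1r.
- exact: pres_addE.
- exact: pres_mulE.
Qed.

Lemma TL_relE n u u' : tl_rel n u u' ->
  eval (in_alg (TL n)) (pres_gen (tl_rel n)) u
  = eval (in_alg (TL n)) (pres_gen (tl_rel n)) u'.
Proof. by move=> h; rewrite !TL_eval; apply/presP/cong_rel. Qed.

Definition incl_gen n (g : tl_gen n) : TL n.+1 :=
  match g with tlS => s0 n.+1 | tlU i => @tU n.+1 (widen_ord (leq_pred n) i) end.

Fact incl_rel n u u' : tl_rel n u u' ->
  eval (in_alg (TL n.+1)) (@incl_gen n) u
  = eval (in_alg (TL n.+1)) (@incl_gen n) u'.
Proof.
pose w (i : 'I_n.-1) : 'I_n.+1.-1 := widen_ord (leq_pred n) i.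
case=> [i|i j ij|i j ij||i i0|i i0].
- exact: (TL_relE (tl_UU (w i))).
- exact: (@TL_relE n.+1 _ _ (@tl_far n.+1 (w i) (w j) ij)).
- exact: (@TL_relE n.+1 _ _ (@tl_braid n.+1 (w i) (w j) ij)).
- exact: (TL_relE (tl_SS n.+1)).
- exact: (@TL_relE n.+1 _ _ (@tl_U1SU1 n.+1 (w i) i0)).
- exact: (@TL_relE n.+1 _ _ (@tl_SU n.+1 (w i) i0)).
Qed.

Definition incl n : TL n -> TL n.+1 := lift (in_alg (TL n.+1)) (@incl_gen n).

Section Incl.
Variable n : nat.
Let cC (a : k) (z : TL n.+1) : a%:A * z = z * a%:A.
Proof. by rewrite mulr_algl mulr_algr. Qed.
Fact incl_linear : linear (@incl n).
Proof.
move=> a u u'; rewrite [LHS]liftD ?[in LHS]liftZ; do ?[exact: cC | exact: incl_rel].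
by rewrite mulr_algl.
Qed.
Fact incl_monoid : monoid_morphism (@incl n).
Proof.
split; first by apply: lift1; [exact: cC | exact: incl_rel].
by move=> u u'; apply: liftM; [exact: cC | exact: incl_rel].
Qed.
HB.instance Definition _ :=
  GRing.isLinear.Build k (TL n) (TL n.+1) _ (@incl n) incl_linear.
HB.instance Definition _ := GRing.isMonoidMorphism.Build
  (TL n) (TL n.+1) (@incl n) incl_monoid.
Lemma incl_s0 : incl (s0 n) = s0 n.+1.
Proof. by apply: lift_gen; [exact: cC | exact: incl_rel]. Qed.
Lemma incl_U (i : 'I_n.-1) :
  incl (tU i) = tU (widen_ord (leq_pred n) i : 'I_n.+1.-1).
Proof. by apply: lift_gen; [exact: cC | exact: incl_rel]. Qed.
End Incl.

(* [jw eta n] is b_{n,eta,e}; the value at n = 0 is a dummy. *)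
Fixpoint jw (eta : sign) (n : nat) : TL n :=
  match n return TL n with
  | 0 => 0
  | m.+1 =>
    (match m return TL m -> TL m.+1 with
     | 0 => fun _ => 2^-1 *: (1 + sgr k eta *: s0 1)
     | p.+1 => fun b =>
        incl b
        + (ee * ((q ^+ p + q ^- p) / (q ^+ p.+1 + q ^- p.+1)))
          *: (incl b * @tU p.+2 ord_max * incl b)
     end) (jw eta m)
  end.

Definition djw (n : nat) : TL n := jw Plus n + jw Minus n.
End TL.

Section Projections.
Variables (k : qfield) (e : sign) (n : nat).

Local Notation V := 'cV[k]_(tdim n).

Definition eigB (lam : k) : {vspace V} :=
  passmx.leigenspace (linfun (mulmx (act (Vn k e n) (uB k)))) lam.

(* U is a U'_q(gl_1)-submodule isomorphic to L(lam). *)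
Definition is_L (lam : k) (U : {vspace V}) : Prop :=
  [/\ \dim U = 1%N,
      forall u, Uq' u -> forall w, w \in U -> act (Vn k e n) u *m w \in U &
      forall w, w \in U -> act (Vn k e n) (uB k) *m w = lam *: w].

(* P is the projection onto U along W *)
Definition is_proj (P : 'M[k]_(tdim n)) (U W : {vspace V}) : Prop :=
  [/\ (U + W)%VS = fullv, (U :&: W)%VS = 0%VS,
      forall w, w \in U -> P *m w = w &
      forall w, w \in W -> P *m w = 0].

Definition wt (j : nat) : k := qint k (n%:Z - 2 * j%:Z).

(* V_e^{⊗n} is the direct sum of the eigenspaces of B for the values [n - 2j].
   P is the projection along this decomposition onto the summands indexed by
   [lams], each of which is a copy of L(lam), occurring exactly once. *)
Definition is_proj_onto_L (lams : seq k) (P : endU' (Vn k e n)) : Prop :=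
  (forall lam, lam \in lams -> is_L lam (eigB lam)) /\
  is_proj P (\sum_(lam <- lams) eigB lam)%VS
            (\sum_(j < n.+1 | wt j \notin lams) eigB (wt j))%VS.
End Projections.

(* Main.v *)
(* By induction on n, b_{n+1,eta} acts as b_{n,eta} ⊗ p, where p is the rank-one
   projection (q^n + q^-n)^-1 [[q^-n, s], [s, q^n]] of V with s = eta e^n: the
   recursion for b_{n+1} sandwiches U_n between two such rank-one factors.
   More generally, if B w = s [m] w with s = 1 or -1, then B acts on w ⊗ V by
   s [m] K^-1 + e κ, a 2 x 2 matrix with eigenvalues e s [m+1] and e s [m-1] and
   eigenprojections of the same shape as p. Iterating this splits the identity
   of V^{⊗n} into commuting eigenprojections of B indexed by 0 <= j <= n, with
   eigenvalue e^n [n-2j]. Those for j = 0 and j = n have rank one and are the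
   images of b_{n,+} and b_{n,-}. *)

Require Import Defs.
From mathcomp Require Import all_boot all_order all_algebra ring.
From mathcomp Require Import reals mxtens.

Set Implicit Arguments.
Unset Strict Implicit.
Unset Printing Implicit Defensive.

Import GRing.Theory.
Local Open Scope ring_scope.

(** * Quantum integers and powers of q *)

Section QIntegers.
Variable k : qfield.
Local Notation q := (@q k).

Lemma qexpz_eq1 (m : int) : (q ^ m == 1) = (m == 0).
Proof.
have h n : (q ^+ n.+1 == 1) = false by apply/negbTE/q_expn_neq1.
case: m => [[|n]|n]; first by rewrite expr0z !eqxx.
  by rewrite -exprnP h.
by rewrite NegzE -exprnN invr_eq1 h.
Qed.

(** Squaring would give [m = 0], and then [1 = -1], against characteristic other than 2. *)
Lemma qexpz_neqN1 (m : int) : q ^ m != -1.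
Proof.
apply/eqP => E; have : q ^ (m * 2) == 1.
  by rewrite -exprz_exp E -exprnP sqrrN expr1n.
rewrite qexpz_eq1 mulf_eq0 orbF => /eqP m0; move: E; rewrite m0 expr0z => E.
have := two_neq0 k; rewrite -[2]/(1 + 1 : k) [X in X + _]E addNr.
by rewrite eqxx.
Qed.

Lemma qexpz_neq0 (m : int) : q ^ m != 0.
Proof. by rewrite expfz_neq0 ?q_neq0. Qed.

Lemma qexpzN1 (m : int) : q ^ (- m) = (q ^ m)^-1.
Proof. by rewrite invr_expz. Qed.

Lemma qexpzD (m n : int) : q ^ (m + n) = q ^ m * q ^ n.
Proof. by rewrite expfzDr ?q_neq0. Qed.

Lemma qsum_neq0 (m : int) : q ^ m + (q ^ m)^-1 != 0.
Proof.
rewrite addr_eq0; apply: contra (qexpz_neqN1 (m + m)) => /eqP E.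
by rewrite qexpzD {1}E mulNr mulVf ?qexpz_neq0.
Qed.

Lemma qintN (m : int) : qint k (- m) = - qint k m.
Proof. by rewrite /qint opprK -mulNr opprB. Qed.

Lemma qint0 : qint k 0 = 0.
Proof. by rewrite /qint oppr0 subrr mul0r. Qed.

(** Multiplied by $q^a$, the difference of the numerators factors as $(q^{a-b}-1)(1+q^{a+b})$, whose
    second factor is nonzero. Hence the weights are distinct. *)
Lemma qint_inj : injective (qint k).
Proof.
move=> a b /(mulIf (invr_neq0 (qBV_neq0 k))); rewrite !qexpzN1 => E.
have: (q ^ a / q ^ b - 1) * (1 + q ^ (a + b)) = 0.
  have [a0 b0] := (qexpz_neq0 a, qexpz_neq0 b); rewrite qexpzD.
  have -> : (q ^ a / q ^ b - 1) * (1 + q ^ a * q ^ b)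
    = q ^ a * ((q ^ a - (q ^ a)^-1) - (q ^ b - (q ^ b)^-1)).
    by field; rewrite a0 b0.
  by rewrite E subrr mulr0.
move/eqP; rewrite mulf_eq0 => /orP[|].
  by rewrite subr_eq0 -qexpzN1 -qexpzD qexpz_eq1 subr_eq0 => /eqP.
by rewrite addrC addr_eq0 (negbTE (qexpz_neqN1 _)).
Qed.

Lemma qsqr_neq1 : q * q - 1 != 0.
Proof. by rewrite subr_eq0 -expr2 q_expn_neq1. Qed.

(** This recursion and [qintS_inv] are the two rows of the eigenvector equation in [proj2_eigen]. *)
Lemma qintS (m : int) : qint k (m + 1) = qint k m * q^-1 + q ^ m.
Proof.
have [[m0 q0] q2] := (qexpz_neq0 m, q_neq0 k, qsqr_neq1).
by rewrite /qint !qexpzN1 qexpzD expr1z; field; rewrite q0 q2 m0.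
Qed.

Lemma qintS_inv (m : int) : qint k (m + 1) = qint k m * q + (q ^ m)^-1.
Proof.
have [[m0 q0] q2] := (qexpz_neq0 m, q_neq0 k, qsqr_neq1).
by rewrite /qint !qexpzN1 qexpzD expr1z; field; rewrite q0 q2 m0.
Qed.

End QIntegers.

(** * Rank-one projections of the two-dimensional module *)

Section Proj2.
Variable k : qfield.
Variable e : sign.
Local Notation q := (@q k).
Local Notation ee := (sgr k e).

(* The projection (1/(q^m + q^-m)) [[q^-m, s], [s, q^m]] for s = 1 or -1. *)
Definition proj2 (s : k) (m : int) : 'M[k]_2 :=
  \matrix_(a, b) ((if a == 0 then (q ^ m)^-1 else s)
                  * (if b == 0 then 1 else s * q ^ m)
                  / (q ^ m + (q ^ m)^-1)).

Lemma mx2P (A B : 'M[k]_2) :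
  A 0 0 = B 0 0 -> A 0 1 = B 0 1 -> A 1 0 = B 1 0 -> A 1 1 = B 1 1 -> A = B.
Proof.
move=> h00 h01 h10 h11; apply/matrixP => i j.
have o2 (l : 'I_2) : l = 0 \/ l = 1.
  by case: l => -[|[|//]] h; [left | right]; apply: val_inj.
by case: (o2 i) => ->; case: (o2 j) => ->.
Qed.

Section Fixed.
Variables (s : k) (m : int).
Hypothesis ss : s * s = 1.
Let c := q ^ m + (q ^ m)^-1.
Let s1 : (s == 1) || (s == -1). Proof. by rewrite -sqrf_eq1 expr2 ss. Qed.
Let c0 : c != 0. Proof. exact: qsum_neq0. Qed.
Let m0 := qexpz_neq0 k m.

Let c2 : q ^ m * q ^ m + 1 != 0.
Proof. by have := mulf_neq0 m0 c0; rewrite /c mulrDr mulfV. Qed.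

Lemma proj2E : [/\ proj2 s m 0 0 = (q ^ m)^-1 / c, proj2 s m 0 1 = s / c,
  proj2 s m 1 0 = s / c & proj2 s m 1 1 = q ^ m / c].
Proof.
rewrite !mxE /= -/c !mulr1; split=> //.
  by rewrite mulrCA mulVf ?mulr1.
by rewrite !mulrA ss mul1r.
Qed.

Lemma proj2_tr : (proj2 s m)^T = proj2 s m.
Proof.
have [h00 h01 h10 h11] := proj2E.
by apply: mx2P; rewrite mxE ?h01 ?h10.
Qed.

Lemma proj2_rank1 : exists (u : 'cV[k]_2) (f : 'rV[k]_2),
  proj2 s m = u *m f /\ f *m u = 1%:M.
Proof.
exists (\col_a (if a == 0 then (q ^ m)^-1 else s)).
exists (\row_b ((if b == 0 then 1 else s * q ^ m) / c)); split.
  by apply/matrixP=> a b; rewrite !mxE big_ord_recl big_ord0 addr0 !mxE mulrA.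
apply/matrixP=> i j; rewrite !ord1 !mxE !big_ord_recl big_ord0 !mxE /=.
rewrite addr0 mul1r (_ : s * q ^ m / _ * s = s * s * (q ^ m / c));
  last by rewrite /c; ring.
by rewrite ss mul1r [_^-1 * _]mulrC -mulrDl addrC mulfV.
Qed.

(** For $p=uf$ of rank one, $pE_{ij}p=u(fe_i)(e_j^Tu)f$, and the two scalars multiply to
    $p_{ji}$. *)
Lemma proj2_sandwich i j :
  proj2 s m *m delta_mx i j *m proj2 s m = proj2 s m j i *: proj2 s m.
Proof.
apply/matrixP => a b; rewrite [RHS]mxE mxE (bigD1 j) //= big1 ?addr0.
  rewrite mxE (bigD1 i) //= big1 ?addr0 => [|l /negbTE li]; last first.
    by rewrite [X in _ * X]mxE li /= mulr0.
  by rewrite [X in _ * X * _]mxE !eqxx mulr1 !mxE; ring.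
move=> l /negbTE lj; rewrite mxE big1 ?mul0r // => r _.
by rewrite [X in _ * X]mxE lj andbF mulr0.
Qed.

(** Changing both signs keeps the denominator, swaps the diagonal entries, which add up to 1, and
    negates the off-diagonal ones. *)
Lemma proj2N : proj2 (- s) (- m) = 1%:M - proj2 s m.
Proof.
have [h00 h01 h10 h11] := proj2E.
apply: mx2P; rewrite [RHS]mxE [X in _ + X]mxE ?(h00, h01, h10, h11) !mxE /=
  qexpzN1 invrK ?mulr1n ?mulr0n ?sub0r /c.
- by field; rewrite ?m0 ?c2.
- by field; rewrite ?m0 ?c2.
- by field; rewrite ?m0 ?c2.
rewrite mulrA mulrNN ss.
by field; rewrite ?m0 ?c2.
Qed.

Lemma dyad2E : [/\ vx k *m (vx k)^T = delta_mx 0 0, vx k *m (vy k)^T = delta_mx 0 1,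
  vy k *m (vx k)^T = delta_mx 1 0 & vy k *m (vy k)^T = delta_mx 1 1].
Proof. by rewrite /vx /vy !trmx_delta !mul_delta_mx. Qed.

(* [s [m] K^-1 + B] is the action of B on w ⊗ V when B w = s [m] w. *)
Lemma proj2_eigen :
  ((s * qint k m) *: vKi k e + ee *: kappa k) *m proj2 s m
  = (ee * s * qint k (m + 1)) *: proj2 s m.
Proof.
have [Exx Exy Eyx Eyy] := dyad2E; have [h00 h01 h10 h11] := proj2E.
rewrite /vKi /kappa Exx Exy Eyx Eyy.
apply: mx2P; rewrite !mxE !big_ord_recl !big_ord0 (_ : lift _ _ = 1);
  do ?exact: val_inj.
all: rewrite ?(h00, h01, h10, h11) ![in LHS]mxE /=.
all: rewrite !(mulr1n, mulr0n, mulr0, mulr1, addr0, add0r).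
all: rewrite -?/c; have /orP[/eqP->|/eqP->] := s1.
1-4: by rewrite qintS; field; rewrite ?m0 ?c0 ?q_neq0.
all: by rewrite qintS_inv; field; rewrite ?m0 ?c0 ?q_neq0.
Qed.

Let c1 := q ^ (m + 1) + (q ^ (m + 1))^-1.

(** By [Hpure], H is a sum of tensors of matrix units, and [proj2_sandwich] turns each left factor
    into a multiple of [proj2 s m]. What remains is an identity of 2 x 2 matrices in the right
    factor. *)
Lemma proj2_step :
  (ee * (c / c1)) *: ((proj2 s m *t 1%:M) *m Hmx k e *m (proj2 s m *t 1%:M))
  = proj2 s m *t (proj2 (ee * s) (m + 1) - 1%:M).
Proof.
have [Exx Exy Eyx Eyy] := dyad2E; have [h00 h01 h10 h11] := proj2E.
rewrite Hpure Exx Exy Eyx Eyy !(mulmxDr, mulmxDl, =^~ scalemxAr, =^~ scalemxAl).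
rewrite !tensmx_mul !mul1mx !mulmx1 !proj2_sandwich !tensZl h00 h01 h10 h11.
rewrite -!tensZr -!tensDr -!tensZr -!tensDr -!tensZr; congr (_ *t _).
have := qsum_neq0 k (m + 1); rewrite /c1 qexpzD expr1z => n1.
have n2 : (q ^ m * q) * (q ^ m * q) + 1 != 0.
  have mq : q ^ m * q != 0 by rewrite mulf_neq0 ?m0 ?q_neq0.
  by have := mulf_neq0 mq n1; rewrite mulrDr mulfV.
apply: mx2P; rewrite !mxE /= !(mulr1n, mulr0n, mulr0, mulr1, addr0, add0r) qexpzD expr1z.
all: have /orP[/eqP s_|/eqP s_] := s1; case: e; rewrite /sgr /c ?s_.
all: by field; rewrite ?m0 ?c2 ?q_neq0 ?n2.
Qed.



End Fixed.
End Proj2.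


Lemma proj2_0 (k : qfield) (eta : sign) :
  proj2 (sgr k eta) 0 = 2^-1 *: (1%:M + sgr k eta *: kappa k).
Proof.
have [_ Exy Eyx _] := dyad2E k; rewrite /kappa Exy Eyx.
have [h00 h01 h10 h11] := proj2E 0 (sgr2 k eta).
apply: mx2P; rewrite ?(h00, h01, h10, h11) !mxE /= expr0z invr1 -[1 + 1]/2.
all: by rewrite ?(mulr1n, mulr0n, mulr0, mulr1, mul1r, addr0, add0r) // mulrC.
Qed.

(** * Spectral decomposition of B on the tensor powers *)

Section EigenProjections.
Variable k : qfield.
Variable e : sign.
Local Notation q := (@q k).
Local Notation ee := (sgr k e).
Local Notation Bn n := (act (Vn k e n) (uB k)).

(* The projection onto the eigenspace of B for the eigenvalue e^n [n - 2j]. *)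
Fixpoint eigproj (n j : nat) : 'M[k]_(tdim n) :=
  match n return 'M[k]_(tdim n) with
  | 0 => (j == 0)%:R%:M
  | m.+1 => eigproj m j *t proj2 (ee ^+ m) (m%:Z - 2 * j%:Z)
      + (if j is i.+1
         then eigproj m i *t proj2 (- ee ^+ m) (- (m%:Z - 2 * i%:Z)) else 0)
  end.

Lemma sgrX2 n : ee ^+ n * ee ^+ n = 1.
Proof. by rewrite -exprMn sgr2 expr1n. Qed.

Lemma sgr_sgrX2 eta n : sgr k eta * ee ^+ n * (sgr k eta * ee ^+ n) = 1.
Proof. by rewrite mulrACA sgr2 sgrX2 mulr1. Qed.

Lemma sgrX_pm1 n : ee ^+ n = 1 \/ ee ^+ n = -1.
Proof. by apply/pred2P; rewrite -sqrf_eq1 expr2 sgrX2. Qed.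

Lemma sgrX_neq0 n : ee ^+ n != 0.
Proof. by apply/eqP => E; have /eqP := sgrX2 n; rewrite E mul0r eq_sym oner_eq0. Qed.

Lemma eigproj_gt n j : (n < j)%N -> eigproj n j = 0.
Proof.
elim: n j => [|n IH] [|j] //= nj; first by rewrite raddf0.
by rewrite !IH ?tens0mx ?addr0 // ltnW.
Qed.

(** [eigproj n j] contributes to the indices j and j+1 of the next level, and by [proj2N] the two
    contributions add up to [eigproj n j *t 1%:M]. *)
Lemma sum_eigproj n : \sum_(j < n.+1) eigproj n j = 1%:M.
Proof.
elim: n => [|n IH]; first by rewrite big_ord_recl big_ord0 addr0.
(* The first family vanishes at index [n.+1] and the second at index 0; after a shift both run over
   ['I_n.+1]. *)
rewrite /= big_split /= big_ord_recr /= [eigproj n n.+1]eigproj_gt // tens0mx addr0.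
rewrite [X in _ + X]big_ord_recl add0r -big_split /= -tens11 -IH.
rewrite (big_morph (fun A => A *t _) (fun A B => tensDl A B _) (tens0mx _)).
apply: eq_bigr => j _; rewrite proj2N ?sgrX2 // -tensDr; congr (_ *t _).
by rewrite /bump /= addrC subrK.
Qed.

(** On each factor the matrices of $K^{-1}$ and B are symmetric. Transposition thus turns right
    eigenvector equations into left ones. *)
Lemma actB_tr n : (Bn n)^T = Bn n.
Proof.
elim: n => [|n IH]; first by rewrite actB0 trmx0.
have [_ Exy Eyx _] := dyad2E k.
have [Exx _ _ Eyy] := dyad2E k.
rewrite actBn linearD /= !trmx_tens IH trmx1 actBV; congr (_ *t _ + _ *t _).
  by rewrite /vKi Exx Eyy linearD !linearZ /= !trmx_delta.
by rewrite linearZ /= /kappa Exy Eyx linearD /= !trmx_delta addrC.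
Qed.

Lemma eigproj_tr n j : (eigproj n j)^T = eigproj n j.
Proof.
elim: n j => [|n IH] j /=; first by rewrite tr_scalar_mx.
have h1 := sgrX2 n; have h2 : - ee ^+ n * - ee ^+ n = 1 by rewrite mulrNN.
rewrite linearD /= trmx_tens IH proj2_tr //; congr (_ + _).
by case: j => [|j]; rewrite ?trmx0 // trmx_tens IH proj2_tr.
Qed.

Lemma actB_tens_proj2 n (A : 'M[k]_(tdim n)) (s : k) (m : int) : s * s = 1 ->
  Bn n *m A = (s * qint k m) *: A ->
  Bn n.+1 *m (A *t proj2 s m) = (ee * s * qint k (m + 1)) *: (A *t proj2 s m).
Proof.
move=> ss BA; rewrite actBn mulmxDl !tensmx_mul BA mul1mx actBV.
by rewrite tensZl -tensZr -tensDr scalemxAl -mulmxDl proj2_eigen // tensZr.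
Qed.

Lemma actB_eigproj n j : Bn n *m eigproj n j = (ee ^+ n * wt k n j) *: eigproj n j.
Proof.
elim: n j => [|n IH] j.
  rewrite actB0 mul0mx /wt; case: j => [|j]; last by rewrite eigproj_gt // scaler0.
  by rewrite mulr0 subr0 qint0 mulr0 scale0r.
rewrite /= mulmxDr scalerDr; congr (_ + _).
  rewrite actB_tens_proj2 ?sgrX2 //; congr (_ *: _).
  by rewrite -exprS /wt; congr (_ * qint k _); rewrite -[n.+1]addn1 PoszD; ring.
case: j => [|j]; first by rewrite mulmx0 scaler0.
(* The eigenvalue $e^n[n-2j]$ is read as $(-e^n)[-(n-2j)]$, which selects the complementary
   projection. *)
rewrite actB_tens_proj2 ?mulrNN ?sgrX2 //; last first.
  by rewrite qintN mulrNN IH.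
congr (_ *: _); rewrite mulrN mulNr -mulrN -qintN -exprS /wt.
by congr (_ * qint k _); rewrite -[n.+1]addn1 -[j.+1]addn1 !PoszD; ring.
Qed.

Lemma eigproj_actB n j : eigproj n j *m Bn n = (ee ^+ n * wt k n j) *: eigproj n j.
Proof.
apply: trmx_inj; rewrite trmx_mul linearZ /= actB_tr eigproj_tr.
exact: actB_eigproj.
Qed.

Definition extreme (eta : sign) (n : nat) : nat := if eta is Plus then 0 else n.

(** Only one branch of the recursion survives: index 0 has no predecessor, and [eigproj n n.+1]
    vanishes. For [Minus] the weight is $-(n-2n)=n$. *)
Lemma eigproj_extreme eta n :
  eigproj n.+1 (extreme eta n.+1)
  = eigproj n (extreme eta n) *t proj2 (sgr k eta * ee ^+ n) n%:Z.
Proof.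
case: eta => /=; first by rewrite addr0 mul1r mulr0 subr0.
rewrite eigproj_gt // tens0mx add0r mulN1r; congr (_ *t proj2 _ _); ring.
Qed.

Lemma eigproj_rank1 eta n : exists (u : 'cV[k]_(tdim n)) (f : 'rV[k]_(tdim n)),
  eigproj n (extreme eta n) = u *m f /\ f *m u = 1%:M.
Proof.
elim: n => [|n [u [f [E fu]]]].
  by exists 1%:M, 1%:M; rewrite !mulmx1; case: eta.
have ss := sgr_sgrX2 eta n.
have [v [g [E' gv]]] := proj2_rank1 n ss.
(* [1 * 1] is convertible to [1], so a Kronecker product of columns is a column. *)
exists (u *t v : 'M_(_, 1 * 1)), (f *t g : 'M_(1 * 1, _)).
rewrite eigproj_extreme E E'; split; first by apply: esym (tensmx_mul u v f g).
by apply: etrans (tensmx_mul f g u v) _; rewrite fu gv tens11.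
Qed.

Lemma eigproj_idem eta n :
  eigproj n (extreme eta n) *m eigproj n (extreme eta n) = eigproj n (extreme eta n).
Proof.
have [u [f [-> fu]]] := eigproj_rank1 eta n.
by rewrite mulmxA -(mulmxA u) fu mulmx1.
Qed.

End EigenProjections.

(** * Images of the Jones--Wenzl elements *)

Section JonesWenzl.
Variable k : qfield.
Variable e : sign.
Local Notation q := (@q k).
Local Notation ee := (sgr k e).

Let cC n (a : k) (A : 'M[k]_n) : a%:M * A = A * a%:M.
Proof. by rewrite [LHS]mul_scalar_mx [RHS]mul_mx_scalar. Qed.

(** Both sides evaluate the same term, so generators suffice. The smaller algebra has at least one
    factor because [s0mx 0] is the identity while [s0mx 1] is [1%:M *t kappa]. *)
Lemma Psi_mx_incl n (a : TL k e n.+1) : Psi_mx (incl a) = Psi_mx a *t 1%:M.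
Proof.
elim/quotW: a => u.
rewrite /incl lift_pi; [|by move=> c x; rewrite mulr_algl mulr_algr|exact: incl_rel].
rewrite [in RHS]/Psi_mx lift_pi; [|exact: cC|exact: tl_mx_rel].
elim: u => [[|i]|c|u IHu v IHv|u IHu v IHv] /=.
- by rewrite Psi_mx_gen.
- by rewrite Psi_mx_gen /tl_mx Umx_small //; case: i.
- by rewrite Psi_mxZ Psi_mx1 -tens11 -tensZl scalemx1.
- by rewrite Psi_mxD IHu IHv tensDl.
- by rewrite Psi_mxM IHu IHv tensmx_mul mulmx1.
Qed.

Lemma Psi_mx_jw eta n :
  Psi_mx (jw k e eta n.+1) = eigproj k e n.+1 (extreme eta n.+1).
Proof.
elim: n => [|n IH].
  rewrite eigproj_extreme [jw _ _ _ _]/= Psi_mxZ Psi_mxD Psi_mx1 Psi_mxZ.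
  rewrite [Psi_mx (s0 _ _ _)]Psi_mx_gen [tl_mx _ _ _]/= -tens11 -tensZr -tensDr -tensZr.
  by rewrite expr0 mulr1 [proj2 _ _]proj2_0; case: eta.
rewrite /jw -/(jw k e eta n.+1) Psi_mxD Psi_mxZ !Psi_mxM Psi_mx_incl IH.
rewrite Psi_mx_gen /tl_mx [Umx _ _ _ _]Umx_top /top.
rewrite [in RHS]eigproj_extreme !(eigproj_extreme k e eta n).
set P := eigproj _ _ _ _; set p := proj2 _ _.
have ss := sgr_sgrX2 k e eta n.
have := proj2_step e n ss; rewrite -[n%:Z + 1]PoszD addn1 (mulrCA ee (sgr k eta)) -exprS -/p => step.
(* With P split off, the U-term is $P^2=P$ tensored with the left side of [proj2_step]; the $-1$
   there cancels the summand $P\otimes p\otimes 1$. *)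
rewrite -assoc_tens -!assocM !tensmx_mul mulmx1 eigproj_idem -/P -assocZ -tensZr.
by rewrite step -assocD -tensDr -tensDr addrC subrK assoc_tens.
Qed.

End JonesWenzl.

(** * Eigenspaces of B and the projections onto them *)

Section Spectral.
Variable k : qfield.
Variable e : sign.
Variable n : nat.
Local Notation ee := (sgr k e).
Local Notation B := (act (Vn k e n) (uB k)).
Local Notation Y := (eigproj k e n).
Local Notation V := 'cV[k]_(tdim n).

Lemma mem_eigB lam (w : V) : (w \in eigB e n lam) = (B *m w == lam *: w).
Proof.
rewrite /eigB /passmx.leigenspace; apply/eqlfunP/eqP.
  by rewrite !lfunE /= lfunE.
by move=> E; rewrite !lfunE /= lfunE.
Qed.

Lemma eigproj_mem j (w : V) : Y j *m w \in eigB e n (ee ^+ n * wt k n j).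
Proof. by rewrite mem_eigB mulmxA actB_eigproj -scalemxAl. Qed.

(** The product $Y_jBw$, computed from either side, gives $Y_jw$ times two different scalars. *)
Lemma eigproj_kill j lam (w : V) : w \in eigB e n lam ->
  ee ^+ n * wt k n j != lam -> Y j *m w = 0.
Proof.
rewrite mem_eigB => /eqP Bw neq.
have : Y j *m (B *m w) = Y j *m (lam *: w) by rewrite Bw.
rewrite mulmxA eigproj_actB -scalemxAl -scalemxAr => /eqP.
by rewrite -subr_eq0 -scalerBl scaler_eq0 subr_eq0 (negbTE neq) => /eqP.
Qed.

Lemma eigproj_split (w : V) : w = \sum_(j < n.+1) Y j *m w.
Proof. by rewrite -mulmx_suml sum_eigproj mul1mx. Qed.

Lemma wt_rev j : (j <= n)%N -> wt k n (n - j) = - wt k n j.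
Proof. by move=> jn; rewrite /wt -qintN -subzn //; congr (qint k _); ring. Qed.

(** When $e^n=-1$ the sign reverses the list of weights, $j\mapsto n-j$. *)
Lemma wt_sgrX (j : 'I_n.+1) : exists i : 'I_n.+1, ee ^+ n * wt k n j = wt k n i.
Proof.
case: (sgrX_pm1 k e n) => ->; first by exists j; rewrite mul1r.
by exists (rev_ord j); rewrite mulN1r /= subSS wt_rev // -ltnS.
Qed.

Lemma wt_inj (i j : nat) : wt k n i = wt k n j -> i = j.
Proof. by move=> /qint_inj/addrI/oppr_inj/mulfI h; have [] := h isT. Qed.

Lemma eigproj_fix (j : nat) (w : V) : (j <= n)%N ->
  w \in eigB e n (ee ^+ n * wt k n j) -> Y j *m w = w.
Proof.
rewrite -ltnS => jn wj; rewrite [RHS]eigproj_split (bigD1 (Ordinal jn)) //=.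
rewrite big1 ?addr0 // => i ij; apply: (eigproj_kill wj).
by apply: contra ij => /eqP/(mulfI (sgrX_neq0 k e n))/wt_inj Eij; apply/eqP/val_inj.
Qed.

(** Fixing U and killing W forces $U\cap W=0$; $U+W$ is everything because each $Y_jw$ lies in the
    eigenspace of some weight. *)
Lemma is_proj_eigproj (lams : seq k) :
  is_proj (\sum_(j < n.+1 | ee ^+ n * wt k n j \in lams) Y j)
    (\sum_(lam <- lams) eigB e n lam)%VS
    (\sum_(j < n.+1 | wt k n j \notin lams) eigB e n (wt k n j))%VS.
Proof.
set P := \sum_(j < _ | _) _; set U := (\sum_(_ <- _) _)%VS.
set W := (\sum_(_ < _ | _) _)%VS.
have PE (w : V) : P *m w = \sum_(j < n.+1 | ee ^+ n * wt k n j \in lams) Y j *m w.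
  by rewrite mulmx_suml.
have PU w : w \in U -> P *m w = w.
  have E lam (v : V) : lam \in lams -> v \in eigB e n lam -> P *m v = v.
    move=> lin vlam; rewrite PE [RHS]eigproj_split.
    rewrite [RHS](bigID (fun j : 'I__ => ee ^+ n * wt k n j \in lams)) /=.
    rewrite [X in _ = _ + X]big1 ?addr0 // => j jn.
    by apply: (eigproj_kill vlam); apply: contra jn => /eqP ->.
  rewrite /U big_tnth => /memv_sumP [vs vsP ->].
  rewrite mulmx_sumr; apply: eq_bigr => i _; apply: E (vsP i isT).
  exact: mem_tnth.
have PW w : w \in W -> P *m w = 0.
  move=> /memv_sumP [vs vsP ->]; rewrite mulmx_sumr big1 // => i hi.
  rewrite PE big1 // => j hj; apply: eigproj_kill (vsP i hi) _.
  by apply: contra hi => /eqP <-.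
split=> //.
  apply/vspaceP => w; rewrite memvf (eigproj_split w).
  apply: memv_suml => j _; have := eigproj_mem j w.
  have [i ->] := wt_sgrX j.
  case: (boolP (wt k n i \in lams)) => hi h.
    apply: (subvP (addvSl _ _)); rewrite /U big_tnth.
    have [l El] := tnthP (in_tuple lams) _ hi.
    by apply: (subvP (sumv_sup l _ _) _ h); rewrite // El.
  by apply: (subvP (addvSr _ _)); apply: (subvP (sumv_sup i _ _) _ h).
apply/eqP; rewrite -subv0; apply/subvP => w; rewrite memv_cap memv0 => /andP[wU wW].
by rewrite -(PU w wU) PW.
Qed.

(** Since $Y=uf$ has rank one, an eigenvector satisfies $w=Yw=(fw)u$, so the eigenspace is the line
    of u. *)
Lemma is_L_extreme eta : is_L e (ee ^+ n * wt k n (extreme eta n))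
   (eigB e n (ee ^+ n * wt k n (extreme eta n)) : {vspace V}).
Proof.
have [u [f [E fu]]] := eigproj_rank1 k e eta n.
set lam := _ * _.
split.
- have -> : eigB e n lam = <[u]>%VS.
    apply/vspaceP => w; apply/idP/vlineP => [wl|[c ->]].
      exists ((f *m w) 0 0).
      have ext_le : (extreme eta n <= n)%N by case: (eta) => /=.
      rewrite -[LHS](eigproj_fix ext_le wl) E.
      by rewrite -mulmxA [in LHS](mx11_scalar (f *m w)) mul_mx_scalar.
    rewrite memvZ // -[u]mulmx1 -fu mulmxA -E; exact: eigproj_mem.
  rewrite dim_vline; case: eqP => // u0; move: fu; rewrite u0 mulmx0.
  by move/matrixP/(_ 0 0)/eqP; rewrite !mxE eq_sym oner_eq0.
- move=> v; elim=> {v}.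
  + by move=> v -> w; rewrite mem_eigB => /eqP Bw; rewrite Bw memvZ // mem_eigB Bw.
  + by move=> w; rewrite act1 mul1mx.
  + by move=> v v' _ hv _ hv' w wl; rewrite actD mulmxDl memvD ?hv ?hv'.
  + by move=> a v _ hv w wl; rewrite actZ -scalemxAl memvZ ?hv.
  + by move=> v v' _ hv _ hv' w wl; rewrite actM -mulmxA hv ?hv'.
by move=> w; rewrite mem_eigB => /eqP.
Qed.

Lemma wt_extreme eta : wt k n (extreme eta n) = sgr k eta * qint k n.
Proof.
case: eta; rewrite /wt /=; first by rewrite mulr0 subr0 mul1r.
by rewrite mulN1r -qintN; congr (qint k _); ring.
Qed.

Lemma wt_eq_extreme eta (j : 'I_n.+1) :
  (wt k n j == wt k n (extreme eta n)) = (j == inord (extreme eta n)).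
Proof.
have ext_lt : (extreme eta n < n.+1)%N by case: (eta) => /=.
apply/eqP/eqP => [/wt_inj h|->]; last by rewrite inordK.
by apply: val_inj; rewrite /= inordK.
Qed.

Lemma is_proj_onto_L_extreme eta (P : endU' (Vn k e n)) :
  endU'_mx P = Y (extreme eta n) ->
  is_proj_onto_L [:: ee ^+ n * (sgr k eta * qint k n)] P.
Proof.
move=> PE; rewrite -wt_extreme; split.
  by move=> lam; rewrite inE => /eqP ->; apply: is_L_extreme.
have -> : (P : 'M_ _) = \sum_(j < n.+1 | ee ^+ n * wt k n j
    \in [:: ee ^+ n * wt k n (extreme eta n)]) Y j; last exact: is_proj_eigproj.
rewrite PE (big_pred1 (inord (extreme eta n))) ?inordK //; first by case: (eta) => /=.
move=> j; rewrite /= inE -wt_eq_extreme; apply/eqP/eqP => [|-> //].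
by move/(mulfI (sgrX_neq0 k e n)).
Qed.

Lemma is_proj_onto_L_extremes (P : endU' (Vn k e n)) : (0 < n)%N ->
  endU'_mx P = Y (extreme Plus n) + Y (extreme Minus n) ->
  is_proj_onto_L [:: qint k n; - qint k n] P.
Proof.
move=> n0 PE.
(* The sign $e^n$ at most exchanges the two eigenvalues. *)
have lamsE lam : (lam \in [:: qint k n; - qint k n])
    = (lam == ee ^+ n * wt k n (extreme Plus n))
      || (lam == ee ^+ n * wt k n (extreme Minus n)).
  rewrite !wt_extreme !inE mul1r mulN1r mulrN.
  by case: (sgrX_pm1 k e n) => ->; rewrite ?mul1r ?mulN1r ?opprK // orbC.
split.
  by move=> lam; rewrite lamsE => /orP[] /eqP ->; apply: is_L_extreme.
have -> : (P : 'M_ _) = \sum_(j < n.+1 | ee ^+ n * wt k n j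
    \in [:: qint k n; - qint k n]) Y j; last exact: is_proj_eigproj.
have e0 := sgrX_neq0 k e n.
have inE' (j : 'I_n.+1) : (ee ^+ n * wt k n j \in [:: qint k n; - qint k n])
    = (j == ord0) || (j == ord_max).
  rewrite lamsE !(inj_eq (mulfI e0)) !wt_eq_extreme; congr (_ || _); congr (_ == _).
    by apply: val_inj; rewrite /= inordK.
  by apply: val_inj; rewrite /= inordK.
rewrite (eq_bigl _ _ inE') (bigD1 ord0) //= (big_pred1 ord_max) ?PE //.
(* The indices 0 and n are distinct because [n] is positive. *)
move=> j; have [->|_] := eqVneq j ord0; last by rewrite andbT.
by rewrite andbF /= -(inj_eq val_inj) /= eq_sym eqn0Ngt n0.
Qed.

End Spectral.

Theorem theorem5p12 (R : realType) (e : sign) (n : nat) (hn : (1 <= n)%N) :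
  [/\ is_proj_onto_L [:: sgr (Cq R) e ^+ n.-1 * qint (Cq R) n]
        (Psi (jw (Cq R) e e n)),
      is_proj_onto_L [:: - (sgr (Cq R) e ^+ n.-1 * qint (Cq R) n)]
        (Psi (jw (Cq R) e (opps e) n)) &
      is_proj_onto_L [:: qint (Cq R) n; - qint (Cq R) n]
        (Psi (djw (Cq R) e n))].
Proof.
case: n hn => // n _; set k := Cq R.
have jwE eta : endU'_mx (Psi (jw k e eta n.+1)) = eigproj k e n.+1 (extreme eta n.+1).
  exact: Psi_mx_jw.
(* Taking $\eta=e$ cancels one of the n+1 signs in the eigenvalue. *)
have lamE : sgr k e ^+ n.+1 * (sgr k e * qint k n.+1) = sgr k e ^+ n * qint k n.+1.
  by rewrite mulrA exprSr -(mulrA _ _ (sgr k e)) sgr2 mulr1.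
split.
- by rewrite -lamE; apply: is_proj_onto_L_extreme.
- have -> : - (sgr k e ^+ n * qint k n.+1)
      = sgr k e ^+ n.+1 * (sgr k (opps e) * qint k n.+1).
    by rewrite -lamE -mulrN -mulNr; case: (e); rewrite ?opprK.
  exact: is_proj_onto_L_extreme.
- apply: is_proj_onto_L_extremes => //.
  by rewrite [LHS]Psi_mxD -!Psi_mx_jw.
Qed.
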